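(* Let $\Omega\subset\mathbb{C}$ be an exceptional domain with finite connectivity (i.e. $\partial\Omega$ has finitely many connected components) which is not a half-plane, and let $u$ be its associated function. Then $|\nabla u|<1$ everywhere in $\Omega$.
   Context: We identify $\mathbb{R}^2$ with $\mathbb{C}$, writing $z=x+iy$. An open set $\Omega\subset\mathbb{C}$ with non-empty boundary is a smooth domain if, for each $z_0\in\partial\Omega$, there exist $\varepsilon>0$ and a smooth diffeomorphism $\psi$ from $D(z_0,\varepsilon)$ onto an open set $D\subset\mathbb{R}^2$ such that $\psi(D(z_0,\varepsilon)\cap\Omega)=D\cap\{x_2>0\}$ and $\psi(D(z_0,\varepsilon)\cap\partial\Omega)=D\cap\{x_2=0\}$. An exceptional domain is a smooth, connected, unbounded domain $\Omega\subset\mathbb{C}$ with non-empty boundary that admits a function $u$, harmonic in $\Omega$ and $C^1$ up to the boundary, such that $u>0$ in $\Omega$, $u=0$ on $\partial\Omega$, and $|\nabla u|=1$ on $\partial\Omega$. Such a $u$ is unique, and we call it the associated function of $\Omega$. *)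

(* Defs.v *)
From Stdlib Require Import Reals Lra List.
Open Scope R_scope.

Definition pt : Type := (R * R)%type.
Definition pset : Type := pt -> Prop.

Definition dist (p q : pt) : R :=
  sqrt ((fst p - fst q) ^ 2 + (snd p - snd q) ^ 2).

Definition disc (z0 : pt) (eps : R) : pset := fun z => dist z z0 < eps.

Definition is_open (U : pset) : Prop :=
  forall p, U p -> exists e, 0 < e /\ forall q, dist q p < e -> U q.

Definition closure (S : pset) : pset :=
  fun p => forall e, 0 < e -> exists q, S q /\ dist p q < e.

Definition boundary (S : pset) : pset :=
  fun p => closure S p /\ closure (fun q => ~ S q) p.

Definition connected (S : pset) : Prop :=
  ~ (exists A B : pset, is_open A /\ is_open B /\
       (forall p, S p -> A p \/ B p) /\
       (exists p, S p /\ A p) /\ (exists p, S p /\ B p) /\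
       (forall p, S p -> A p -> B p -> False)).

Definition same_component (S : pset) (x y : pt) : Prop :=
  exists C : pset, connected C /\ (forall p, C p -> S p) /\ C x /\ C y.

Definition finitely_many_components (S : pset) : Prop :=
  exists l : list pt, (forall x, In x l -> S x) /\
    forall y, S y -> exists x, In x l /\ same_component S x y.

Definition bounded (S : pset) : Prop :=
  exists M, forall p, S p -> dist p (0, 0) <= M.

Definition partial_x (f : pt -> R) (p : pt) (l : R) : Prop :=
  derivable_pt_lim (fun t => f (t, snd p)) (fst p) l.
Definition partial_y (f : pt -> R) (p : pt) (l : R) : Prop :=
  derivable_pt_lim (fun t => f (fst p, t)) (snd p) l.

Definition continuous_within (S : pset) (f : pt -> R) (p : pt) : Prop :=
  forall e, 0 < e -> exists d, 0 < d /\
    forall q, S q -> dist q p < d -> Rabs (f q - f p) < e.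

Definition continuous_on (S : pset) (f : pt -> R) : Prop :=
  forall p, S p -> continuous_within S f p.

Fixpoint Ck (k : nat) (U : pset) (f : pt -> R) : Prop :=
  match k with
  | O => continuous_on U f
  | S k' => continuous_on U f /\
      exists fx fy : pt -> R,
        (forall p, U p -> partial_x f p (fx p) /\ partial_y f p (fy p)) /\
        Ck k' U fx /\ Ck k' U fy
  end.

Definition smooth_on (U : pset) (f : pt -> R) : Prop := forall k, Ck k U f.

Definition smooth_map_on (U : pset) (F : pt -> pt) : Prop :=
  smooth_on U (fun p => fst (F p)) /\ smooth_on U (fun p => snd (F p)).

Definition smooth_domain (Om : pset) : Prop :=
  is_open Om /\ (exists p, boundary Om p) /\
  forall z0, boundary Om z0 ->
    exists (eps : R) (psi phi : pt -> pt) (D : pset),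
      0 < eps /\ is_open D /\
      (forall z, disc z0 eps z -> D (psi z) /\ phi (psi z) = z) /\
      (forall w, D w -> disc z0 eps (phi w) /\ psi (phi w) = w) /\
      smooth_map_on (disc z0 eps) psi /\ smooth_map_on D phi /\
      (forall w, (D w /\ snd w > 0) <->
                 exists z, disc z0 eps z /\ Om z /\ psi z = w) /\
      (forall w, (D w /\ snd w = 0) <->
                 exists z, disc z0 eps z /\ boundary Om z /\ psi z = w).

Definition harmonic_on (U : pset) (u : pt -> R) : Prop :=
  Ck 2 U u /\
  exists ux uy : pt -> R,
    (forall p, U p -> partial_x u p (ux p) /\ partial_y u p (uy p)) /\
    (forall p, U p -> exists a b, partial_x ux p a /\ partial_y uy p b /\ a + b = 0).

Definition is_associated_function (Om : pset) (u : pt -> R) : Prop :=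
  harmonic_on Om u /\
  (exists gx gy : pt -> R,
     (forall p, Om p -> partial_x u p (gx p) /\ partial_y u p (gy p)) /\
     continuous_on (closure Om) u /\
     continuous_on (closure Om) gx /\ continuous_on (closure Om) gy /\
     (forall p, boundary Om p -> sqrt (gx p ^ 2 + gy p ^ 2) = 1)) /\
  (forall p, Om p -> u p > 0) /\
  (forall p, boundary Om p -> u p = 0).

Definition exceptional_domain (Om : pset) : Prop :=
  smooth_domain Om /\ connected Om /\ ~ bounded Om /\
  exists u, is_associated_function Om u.

Definition is_half_plane (Om : pset) : Prop :=
  exists a b c : R, (a <> 0 \/ b <> 0) /\
    forall p, Om p <-> a * fst p + b * snd p > c.

(* Main.v *)
(** Every interior point p lies in a disc D(p,d) of Om touching the boundary at
    some q.  Harnack's inequality, a logarithmic barrier on an annulus and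
    |grad u(q)| = 1 give u(p) <= e^2 d, and the interior gradient estimate
    |grad u(p)| <= 2 u(p)/d then bounds grad u on all of Om.  Since Om misses a
    disc around some c, adding a small multiple of - log |z - c| to a directional
    derivative e . grad u yields a Phragmen-Lindelof argument, so |grad u| <= 1.
    If equality holds at one point, the strong maximum principle for
    e . grad u makes grad u constant, u affine and Om a half-plane. *)

From Stdlib Require Import Reals Lra Psatz List ClassicalEpsilon.
From Coquelicot Require Import Coquelicot.
Require Import Defs.
Open Scope R_scope.

(** All the potential theory is done with circle means in real variables. [harmonic_on] gives u only
    as a C^2 function, so its partial derivatives P and Q are only known to be C^1 and their
    Laplacians are not at hand; their mean value property comes instead from the Cauchy-Riemann
    equations satisfied by the pair (Q, P). Working with e . grad u for a fixed direction e, rather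
    than with |grad u|, keeps every comparison linear in u, P, Q and log, so mean value equalities
    suffice and no subharmonic function of grad u is needed. The obstacle is infinity: |grad u| = 1
    on the boundary does not control an unbounded domain, and a logarithm absorbs bounded functions
    but not arbitrary growth. Hence the crude bound 2 e^2 has to come before the sharp bound 1. Its
    factor 2 is the ratio of the length 2 pi s of a circle to the area pi s^2 of its disc, up to
    1/s; its factor e^2 comes from integrating |grad u| <= 2 u / r along a segment of length at most
    r. *)

(** * Euclidean distance and continuity in the plane *)

Lemma dist_euc_eq (p q : pt) :
  dist p q = dist_euc (fst p) (snd p) (fst q) (snd q).
Proof. unfold dist, dist_euc, Rsqr. f_equal. ring. Qed.

Lemma dist_triangle (p q r : pt) : dist p r <= dist p q + dist q r.
Proof. rewrite !dist_euc_eq. apply triangle. Qed.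

Lemma dist_sym (p q : pt) : dist p q = dist q p.
Proof. unfold dist. f_equal. ring. Qed.

Lemma dist_pos (p q : pt) : 0 <= dist p q.
Proof. apply sqrt_pos. Qed.

Lemma dist_sq (p q : pt) :
  dist p q ^ 2 = (fst p - fst q) ^ 2 + (snd p - snd q) ^ 2.
Proof. unfold dist. apply pow2_sqrt. apply Rplus_le_le_0_compat; apply pow2_ge_0. Qed.

Lemma dist_refl (p : pt) : dist p p = 0.
Proof.
  assert (H := dist_sq p p). assert (H0 := dist_pos p p). nra.
Qed.

Lemma dist_eq0 (p q : pt) : dist p q = 0 -> p = q.
Proof.
  intros H. assert (E := dist_sq p q). rewrite H in E.
  destruct p as [a b], q as [c d]; simpl in *.
  destruct (Rplus_sqr_eq_0 (a - c) (b - d)). unfold Rsqr; lra. f_equal; lra.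
Qed.

Lemma le_of_sq_le x y : 0 <= y -> x ^ 2 <= y ^ 2 -> x <= y.
Proof. intros H H1. apply Rnot_lt_le. intros H2. nra. Qed.

Lemma abs_le_dist (p q : pt) :
  Rabs (fst p - fst q) <= dist p q /\ Rabs (snd p - snd q) <= dist p q.
Proof.
  assert (E := dist_sq p q). assert (H := dist_pos p q).
  assert (H1 := pow2_ge_0 (fst p - fst q)). assert (H2 := pow2_ge_0 (snd p - snd q)).
  split; apply le_of_sq_le; auto; rewrite pow2_abs; lra.
Qed.

Lemma dist_le_abs (p q : pt) :
  dist p q <= Rabs (fst p - fst q) + Rabs (snd p - snd q).
Proof.
  assert (E := dist_sq p q). assert (H := dist_pos p q).
  assert (A := Rabs_pos (fst p - fst q)). assert (B := Rabs_pos (snd p - snd q)).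
  rewrite <- (pow2_abs (fst p - fst q)), <- (pow2_abs (snd p - snd q)) in E.
  apply le_of_sq_le; nra.
Qed.

Definition plane : UniformSpace := prod_UniformSpace R_UniformSpace R_UniformSpace.

(** The balls of the product uniformity are squares. A disc lies in the square of the same size, and
    the square of half-side d/2 lies in the disc of radius d. *)
Lemma locally_dist (P : pt -> Prop) (p : pt) :
  @locally plane p P <->
  exists d, 0 < d /\ forall q, dist q p < d -> P q.
Proof.
  split.
  - intros [d Hd]. exists d. split; [apply cond_pos|]. intros q Hq.
    apply Hd. destruct (abs_le_dist q p). split.
    + change (Rabs (fst q - fst p) < d). lra.
    + change (Rabs (snd q - snd p) < d). lra.
  - intros [d [Hd HP]]. assert (H2 : 0 < d / 2) by lra.
    exists (mkposreal _ H2). intros q Hq. apply HP.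
    destruct Hq as [H H0].
    assert (E := dist_le_abs q p).
    change (Rabs (@fst R R q - fst p) < d / 2) in H.
    change (Rabs (@snd R R q - snd p) < d / 2) in H0. lra.
Qed.

Definition cont (f : pt -> R) (p : pt) : Prop :=
  @continuous plane R_UniformSpace f p.

Lemma cont_dist (f : pt -> R) (p : pt) :
  cont f p <-> forall e, 0 < e -> exists d, 0 < d /\
    forall q, dist q p < d -> Rabs (f q - f p) < e.
Proof.
  split.
  - intros H e He. apply locally_dist. apply (H (fun y => Rabs (y - f p) < e)).
    exists (mkposreal _ He). intros y Hy. exact Hy.
  - intros H P [e He]. apply locally_dist.
    destruct (H e (cond_pos e)) as [d [Hd Hq]]. exists d. split; auto.
    intros q H1. apply He. apply (Hq q H1).
Qed.

Lemma cont_of_on (U : pset) f p :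
  is_open U -> continuous_on U f -> U p -> cont f p.
Proof.
  intros HU Hf Hp. apply cont_dist. intros e He.
  destruct (Hf p Hp e He) as [d [Hd H]]. destruct (HU p Hp) as [d' [Hd' H']].
  exists (Rmin d d'). split. apply Rmin_pos; auto. intros q Hq.
  apply H. apply H'. eapply Rlt_le_trans; [apply Hq|apply Rmin_r].
  eapply Rlt_le_trans; [apply Hq|apply Rmin_l].
Qed.

Lemma open_locally (U : pset) p : is_open U -> U p -> @locally plane p U.
Proof. intros H Hp. apply locally_dist. apply H, Hp. Qed.

Lemma disc_open p r : is_open (disc p r).
Proof.
  intros q Hq. exists (r - dist q p). unfold disc in *. split. lra.
  intros z Hz. assert (T := dist_triangle z q p). lra.
Qed.

(** * Functions of class C^1 and the chain rule *)

(** The gradient is explicit data, so that sums and products compute it. Continuity of [v] is left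
    out because it follows, see [C1_cont]. *)
Definition C1 (U : pset) (v vx vy : pt -> R) : Prop :=
  forall p, U p -> partial_x v p (vx p) /\ partial_y v p (vy p) /\
    cont vx p /\ cont vy p.

Lemma C1_differentiable (U : pset) v vx vy p :
  is_open U -> C1 U v vx vy -> U p ->
  filterdiff v (@locally (prod_NormedModule _ R_NormedModule R_NormedModule) p)
    (fun h => plus (scal (fst h) (vx p)) (scal (snd h) (vy p))).
Proof.
  intros HU H Hp.
  assert (X : filterdiff (fun q : R * R => v (fst q, snd q))
     (@locally (prod_NormedModule _ R_NormedModule R_NormedModule) (fst p, snd p))
     (fun h => plus (scal (fst h) (vx (fst p, snd p))) (scal (snd h) (vy p)))).
  { apply (is_derive_filterdiff (fun x y => v (x, y)) (fst p) (snd p)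
      (fun x y => vx (x, y)) (vy p)).
    - destruct p as [a b]. simpl.
      generalize (open_locally U (a, b) HU Hp). apply filter_imp.
      intros [c d] Hq. simpl. apply is_derive_Reals. apply (H _ Hq).
    - apply is_derive_Reals. apply (H _ Hp).
    - destruct (H p Hp) as [_ [_ [Hc _]]]. destruct p as [a b]. simpl.
      eapply continuous_ext; [|exact Hc]. intros [c d]; reflexivity. }
  destruct p as [a b]; simpl in *.
  eapply filterdiff_ext; [|exact X]. intros [c d]; reflexivity.
Qed.

Lemma C1_cont (U : pset) v vx vy p :
  is_open U -> C1 U v vx vy -> U p -> cont v p.
Proof.
  intros HU H Hp. 
  apply (filterdiff_continuous (U := prod_NormedModule _ R_NormedModule R_NormedModule) v p).
  eexists. eapply C1_differentiable; eauto.
Qed.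

Lemma C1_comp (U : pset) v vx vy (x y : R -> R) (t x' y' : R) :
  is_open U -> C1 U v vx vy -> U (x t, y t) ->
  is_derive x t x' -> is_derive y t y' ->
  is_derive (fun t => v (x t, y t)) t
    (vx (x t, y t) * x' + vy (x t, y t) * y').
Proof.
  intros HU H Hp Hx Hy.
  assert (D := C1_differentiable _ _ _ _ _ HU H Hp).
  assert (D2 : differentiable_pt_lim (fun a b => v (a, b)) (x t) (y t)
     (vx (x t, y t)) (vy (x t, y t))).
  { apply filterdiff_differentiable_pt_lim.
    eapply filterdiff_ext; [|eapply filterdiff_ext_lin; [exact D|]].
    intros [a b]; reflexivity.
    intros [a b]; unfold plus, scal, mult; simpl; unfold mult; simpl; ring. }
  apply is_derive_Reals.
  apply (derivable_pt_lim_comp_2d (fun a b => v (a, b)) x y t _ _ _ _ D2);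
    apply is_derive_Reals; assumption.
Qed.

(** * Mean values over circles *)

Definition circ (p : pt) (r a : R) : pt :=
  (fst p + r * cos a, snd p + r * sin a).

Lemma circ_dist p r a : dist (circ p r a) p = Rabs r.
Proof.
  unfold dist, circ; simpl. rewrite <- sqrt_Rsqr_abs. f_equal.
  assert (H := sin2_cos2 a). unfold Rsqr in *. 
  transitivity (r * r * (sin a * sin a + cos a * cos a)). ring. rewrite H. ring.
Qed.

Lemma cont_circ2 (f : pt -> R) p s t : cont f (circ p s t) ->
  @continuous plane R_UniformSpace (fun q => f (circ p (fst q) (snd q))) (s, t).
Proof.
  intros H.
  apply (continuous_comp_2 (U := plane) (V := R_UniformSpace) (W := R_UniformSpace)
    (fun q => fst p + fst q * cos (snd q)) (fun q => snd p + fst q * sin (snd q))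
    (fun a b => f (a, b))).
  - apply (continuous_plus (V := R_NormedModule)). apply continuous_const.
    apply (continuous_mult (K := R_AbsRing)). apply continuous_fst.
    apply (continuous_comp (U := plane) snd cos).
    apply continuous_snd. apply continuous_cos.
  - apply (continuous_plus (V := R_NormedModule)). apply continuous_const.
    apply (continuous_mult (K := R_AbsRing)). apply continuous_fst.
    apply (continuous_comp (U := plane) snd sin).
    apply continuous_snd. apply continuous_sin.
  - eapply continuous_ext; [|exact H]. intros [a b]; reflexivity.
Qed.

Lemma cont_circ (f : pt -> R) p s t : cont f (circ p s t) ->
  continuous (fun a => f (circ p s a)) t.
Proof.
  intros H.
  apply (continuous_comp_2 (fun _ : R => s) (fun a => a)
    (fun a b => f (circ p a b))).
  apply continuous_const. apply continuous_id. apply cont_circ2, H.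
Qed.

Definition radial (gx gy : pt -> R) (p : pt) (s a : R) : R :=
  gx (circ p s a) * cos a + gy (circ p s a) * sin a.

Lemma cont_radial2 gx gy p s t :
  cont gx (circ p s t) -> cont gy (circ p s t) ->
  @continuous plane R_UniformSpace (fun q => radial gx gy p (fst q) (snd q)) (s, t).
Proof.
  intros H1 H2. unfold radial.
  apply (continuous_plus (V := R_NormedModule));
  apply (continuous_mult (K := R_AbsRing)).
  apply cont_circ2, H1. apply (continuous_comp (U := plane) snd cos).
    apply continuous_snd. apply continuous_cos.
  apply cont_circ2, H2. apply (continuous_comp (U := plane) snd sin).
    apply continuous_snd. apply continuous_sin.
Qed.

Lemma circ_derive_r U v vx vy p s t :
  is_open U -> C1 U v vx vy -> U (circ p s t) ->
  is_derive (fun s => v (circ p s t)) s (radial vx vy p s t).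
Proof.
  intros HU H Hp. unfold radial, circ.
  apply (C1_comp U v vx vy (fun s => fst p + s * cos t) (fun s => snd p + s * sin t) s);
   auto; auto_derive; auto; ring.
Qed.

Lemma circ_derive_a U v vx vy p s t :
  is_open U -> C1 U v vx vy -> U (circ p s t) ->
  is_derive (fun t => v (circ p s t)) t
    (s * (vy (circ p s t) * cos t - vx (circ p s t) * sin t)).
Proof.
  intros HU H Hp. unfold circ.
  eapply is_derive_ext_loc; [|evar_last; [
  apply (C1_comp U v vx vy (fun t => fst p + s * cos t) (fun t => snd p + s * sin t) t
    (s * - sin t) (s * cos t)) |]]; auto.
  - apply filter_forall; reflexivity.
  - auto_derive; auto; ring.
  - auto_derive; auto; ring.
  - simpl. ring.
Qed.

Definition cint (f : pt -> R) (p : pt) (s : R) : R :=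
  RInt (fun a => f (circ p s a)) 0 (2 * PI).

Lemma ex_cint (U : pset) f p s r :
  (forall q, U q -> cont f q) -> (forall q, disc p r q -> U q) -> Rabs s < r ->
  ex_RInt (fun a => f (circ p s a)) 0 (2 * PI).
Proof.
  intros Hf HU Hs. apply (ex_RInt_continuous (V := R_CompleteNormedModule)).
  intros z _. apply cont_circ. apply Hf, HU. unfold disc. rewrite circ_dist. exact Hs.
Qed.

(** Differentiation under the integral sign: the derivative of a circle integral in the radius is
    the flux of the gradient, up to the factor s. *)
Lemma cint_derive U v vx vy p r s :
  is_open U -> C1 U v vx vy -> (forall q, disc p r q -> U q) -> Rabs s < r ->
  is_derive (cint v p) s (RInt (radial vx vy p s) 0 (2 * PI)).
Proof.
  intros HU H Hr Hs.
  assert (Hn : forall s t, Rabs s < r -> U (circ p s t)).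
  { intros s' t Hs'. apply Hr. unfold disc. rewrite circ_dist. exact Hs'. }
  assert (Hl : locally s (fun s' => Rabs s' < r)).
  { assert (P : 0 < r - Rabs s) by lra. exists (mkposreal _ P).
    assert (K : forall y : R, Rabs (y - s) < r - Rabs s -> Rabs y < r).
    { intros y Hy. assert (T := Rabs_triang (y - s) s).
      replace (y - s + s) with y in T by ring. lra. }
    intros y Hy. apply K, Hy. }
  assert (D : forall s t, Rabs s < r ->
    Derive (fun z => v (circ p z t)) s = radial vx vy p s t).
  { intros. apply is_derive_unique. eapply circ_derive_r; eauto. }
  unfold cint.
  evar_last.
  - apply (is_derive_RInt_param (fun s t => v (circ p s t))).
    + revert Hl. apply filter_imp. intros y Hy t _. eexists. eapply circ_derive_r; eauto.
    + intros t _. apply continuity_2d_pt_ext_loc with (f := radial vx vy p).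
      * destruct Hl as [d Hd]. exists d. intros u w Hu _. symmetry. apply D. apply Hd. exact Hu.
      * apply continuity_2d_pt_filterlim.
        apply cont_radial2; eapply H; auto.
    + revert Hl. apply filter_imp. intros y Hy.
      eapply ex_cint; eauto. intros q Hq. eapply C1_cont; eauto.
  - apply RInt_ext. intros t _. apply D, Hs.
Qed.

Lemma RInt_periodic_derive (g g' : R -> R) :
  (forall t, is_derive g t (g' t)) -> (forall t, continuous g' t) ->
  g (2 * PI) = g 0 -> RInt g' 0 (2 * PI) = 0.
Proof.
  intros H Hc E. apply is_RInt_unique.
  evar_last. apply (is_RInt_derive g g'); auto.
  rewrite E. apply (minus_eq_zero (G := R_AbelianGroup)).
Qed.

Lemma circ_2PI p s : circ p s (2 * PI) = circ p s 0.
Proof. unfold circ. rewrite cos_2PI, sin_2PI, cos_0, sin_0. reflexivity. Qed.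

Lemma eq_of_derive0 (F : R -> R) s : 0 <= s ->
  (forall x, 0 <= x <= s -> continuous F x) ->
  (forall x, 0 < x < s -> is_derive F x 0) -> F s = F 0.
Proof.
  intros Hs Hc Hd.
  assert (E : exists c, Rmin 0 s <= c <= Rmax 0 s /\ F s - F 0 = 0 * (s - 0)).
  { apply (MVT_gen F 0 s (fun _ => 0)); rewrite Rmin_left, Rmax_right by lra.
    - exact Hd.
    - intros x Hx. apply continuity_pt_filterlim, Hc, Hx. }
  destruct E as [c [_ E]]. lra.
Qed.

Lemma cint_0 v p : cint v p 0 = 2 * PI * v p.
Proof.
  unfold cint. rewrite (RInt_ext _ (fun _ => v p)).
  - rewrite RInt_const. unfold scal; simpl; unfold mult; simpl. ring.
  - intros. f_equal. unfold circ. destruct p; simpl. f_equal; ring.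
Qed.

Lemma cint_const U v vx vy p r s :
  is_open U -> C1 U v vx vy -> (forall q, disc p r q -> U q) -> 0 <= s < r ->
  (forall t, 0 < t < s -> RInt (radial vx vy p t) 0 (2 * PI) = 0) ->
  cint v p s = 2 * PI * v p.
Proof.
  intros HU H Hr Hs H0. rewrite <- cint_0. apply eq_of_derive0. lra.
  - intros x Hx. apply (ex_derive_continuous (V := R_NormedModule)). eexists.
    eapply cint_derive; eauto. apply Rabs_def1; lra.
  - intros x Hx. rewrite <- (H0 x Hx). eapply cint_derive; eauto. apply Rabs_def1; lra.
Qed.

(** By Cauchy-Riemann the radial derivative of v is 1/t times the angular derivative of w, whose
    integral over a full turn vanishes. Only first derivatives enter, so this applies to the
    components of a gradient. *)
Lemma mean_value_conj U v vx vy w wx wy p r s :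
  is_open U -> C1 U v vx vy -> C1 U w wx wy ->
  (forall q, U q -> vx q = wy q /\ vy q = - wx q) ->
  (forall q, disc p r q -> U q) -> 0 <= s < r ->
  cint v p s = 2 * PI * v p.
Proof.
  intros HU Hv Hw HCR Hr Hs.
  eapply cint_const; eauto. intros t Ht.
  assert (Hn : forall a, U (circ p t a)).
  { intros a. apply Hr. unfold disc. rewrite circ_dist. apply Rabs_def1; lra. }
  apply RInt_periodic_derive with (g := fun a => / t * w (circ p t a)).
  - intros a. evar_last. apply is_derive_scal. apply (circ_derive_a U w wx wy); auto.
    unfold radial. destruct (HCR _ (Hn a)) as [-> ->]. field. lra.
  - intros a. apply (continuous_comp_2 (fun _ : R => t) (fun a => a) (radial vx vy p)).
    apply continuous_const. apply continuous_id. apply cont_radial2; eapply Hv; auto.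
  - rewrite circ_2PI. reflexivity.
Qed.

(** * Algebra of continuous and C^1 functions *)

Lemma cont_const c p : cont (fun _ => c) p.
Proof. apply continuous_const. Qed.

Lemma cont_plus f g p : cont f p -> cont g p -> cont (fun q => f q + g q) p.
Proof. apply (continuous_plus (V := R_NormedModule)). Qed.

Lemma cont_mult f g p : cont f p -> cont g p -> cont (fun q => f q * g q) p.
Proof. apply (continuous_mult (K := R_AbsRing)). Qed.

Lemma continuous_Rplus (f g : R -> R) (t : R) :
  continuous f t -> continuous g t -> continuous (fun a => f a + g a) t.
Proof. apply (continuous_plus (V := R_NormedModule)). Qed.

Lemma continuous_Rmult (f g : R -> R) (t : R) :
  continuous f t -> continuous g t -> continuous (fun a => f a * g a) t.
Proof. apply (continuous_mult (K := R_AbsRing)). Qed.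

Lemma cont_fst p : cont fst p.
Proof. destruct p. apply continuous_fst. Qed.

Lemma cont_snd p : cont snd p.
Proof. destruct p. apply continuous_snd. Qed.

Lemma C1_const U c : C1 U (fun _ => c) (fun _ => 0) (fun _ => 0).
Proof.
  intros p _. repeat split; try apply derivable_pt_lim_const; apply cont_const.
Qed.

Lemma C1_lin U e1 e2 (z : pt) :
  C1 U (fun q => e1 * (fst q - fst z) + e2 * (snd q - snd z))
    (fun _ => e1) (fun _ => e2).
Proof.
  intros p _. repeat split; try apply cont_const;
    apply is_derive_Reals; simpl; auto_derive; auto; ring.
Qed.

Lemma C1_plus U f fx fy g gx gy : C1 U f fx fy -> C1 U g gx gy ->
  C1 U (fun q => f q + g q) (fun q => fx q + gx q) (fun q => fy q + gy q).
Proof.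
  intros Hf Hg p Hp. destruct (Hf p Hp) as [A [B [C D]]], (Hg p Hp) as [A' [B' [C' D']]].
  split; [|split; [|split; apply cont_plus; auto]].
  apply (derivable_pt_lim_plus (fun t => f (t, snd p)) (fun t => g (t, snd p))); auto.
  apply (derivable_pt_lim_plus (fun t => f (fst p, t)) (fun t => g (fst p, t))); auto.
Qed.

Lemma C1_mult U f fx fy g gx gy : is_open U -> C1 U f fx fy -> C1 U g gx gy ->
  C1 U (fun q => f q * g q) (fun q => fx q * g q + f q * gx q)
    (fun q => fy q * g q + f q * gy q).
Proof.
  intros HU Hf Hg p Hp.
  assert (cf := C1_cont _ _ _ _ _ HU Hf Hp). assert (cg := C1_cont _ _ _ _ _ HU Hg Hp).
  destruct (Hf p Hp) as [A [B [C D]]], (Hg p Hp) as [A' [B' [C' D']]].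
  split; [|split; [|split; apply cont_plus; apply cont_mult; auto]].
  - assert (X := derivable_pt_lim_mult (fun t => f (t, snd p)) (fun t => g (t, snd p)) _ _ _ A A').
    destruct p; exact X.
  - assert (X := derivable_pt_lim_mult (fun t => f (fst p, t)) (fun t => g (fst p, t)) _ _ _ B B').
    destruct p; exact X.
Qed.

Lemma C1_sub (U V : pset) v vx vy : (forall p, V p -> U p) -> C1 U v vx vy -> C1 V v vx vy.
Proof. intros H Hv p Hp. apply Hv, H, Hp. Qed.

(** * Harmonic functions *)

(* A C^2 harmonic function together with its gradient (P, Q); the Laplace
   equation is encoded in Q_y = - P_x and the symmetry of the Hessian in Q_x = P_y. *)
Definition harm (U : pset) (u P Q : pt -> R) : Prop :=
  C1 U u P Q /\ exists Px Py,
    C1 U P Px Py /\ C1 U Q Py (fun p => - Px p).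

Section MeanValue.

Variables (U : pset) (u P Q : pt -> R) (p : pt) (r : R).
Hypothesis openU : is_open U.
Hypothesis Hu : harm U u P Q.
Hypothesis Hr : forall q, disc p r q -> U q.

Lemma mean_value_Q s : 0 <= s < r -> cint Q p s = 2 * PI * Q p.
Proof.
  intros Hs. destruct Hu as [_ [Px [Py [HP HQ]]]].
  apply (mean_value_conj U Q Py (fun p => - Px p) P Px Py p r); auto.
Qed.

Lemma mean_value_P s : 0 <= s < r -> cint P p s = 2 * PI * P p.
Proof.
  intros Hs. destruct Hu as [_ [Px [Py [HP HQ]]]].
  assert (HN := C1_mult U _ _ _ _ _ _ openU (C1_const U (-1)) HQ).
  eapply mean_value_conj; [exact openU|exact HP|exact HN| |exact Hr|exact Hs].
  intros q Hq; split; simpl; ring.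
Qed.

Lemma circ_in s t : 0 <= s < r -> U (circ p s t).
Proof.
  intros Hs. apply Hr. unfold disc. rewrite circ_dist. apply Rabs_def1; lra.
Qed.

(* The flux of grad u is the real part of the mean value of (z - p)(P - iQ), which vanishes at p. *)
Lemma mean_value s : 0 <= s < r -> cint u p s = 2 * PI * u p.
Proof.
  intros Hs. destruct Hu as [H1 [Px [Py [HP HQ]]]].
  eapply cint_const; eauto. intros t Ht.
  assert (lx := C1_lin U 1 0 p). assert (ly := C1_lin U 0 1 p).
  assert (lnx := C1_lin U (-1) 0 p).
  assert (V := C1_plus _ _ _ _ _ _ _ (C1_mult _ _ _ _ _ _ _ openU lx HP) (C1_mult _ _ _ _ _ _ _ openU ly HQ)).
  assert (W := C1_plus _ _ _ _ _ _ _ (C1_mult _ _ _ _ _ _ _ openU ly HP) (C1_mult _ _ _ _ _ _ _ openU lnx HQ)).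
  assert (M : cint (fun q => (1 * (fst q - fst p) + 0 * (snd q - snd p)) * P q +
      (0 * (fst q - fst p) + 1 * (snd q - snd p)) * Q q) p t = 0).
  { erewrite mean_value_conj; [|exact openU|exact V|exact W| |exact Hr|lra].
    simpl; ring. intros q Hq; split; simpl; ring. }
  assert (Ft : forall a, U (circ p t a)) by (intros; apply circ_in; lra).
  assert (E : t * RInt (radial P Q p t) 0 (2 * PI) = 0).
  { etransitivity; [|exact M]. unfold cint.
    change (scal t (RInt (radial P Q p t) 0 (2 * PI)) = RInt (fun a =>
      (1 * (fst (circ p t a) - fst p) + 0 * (snd (circ p t a) - snd p)) * P (circ p t a) +
      (0 * (fst (circ p t a) - fst p) + 1 * (snd (circ p t a) - snd p)) * Q (circ p t a)) 0 (2 * PI)).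
    rewrite <- (RInt_scal (V := R_CompleteNormedModule)).
    apply RInt_ext. intros a _. unfold radial, circ, scal; simpl; unfold mult; simpl. ring.
    apply (ex_RInt_continuous (V := R_CompleteNormedModule)). intros a _.
    apply (continuous_comp_2 (fun _ : R => t) (fun a => a) (radial P Q p)).
    apply continuous_const. apply continuous_id. apply cont_radial2; eapply H1; auto. }
  apply Rmult_integral in E. destruct E; [lra|assumption].
Qed.

(** Put W = (e . (q - p)) u. Its Laplacian is 2 e . grad u, so its integral over the circle of
    radius s is pi s^2 D. On that circle W <= s u because |e| <= 1 and u >= 0, and the mean value of
    u bounds the integral by 2 pi s u(p). *)
Lemma grad_bound e1 e2 : 0 < r -> (forall q, disc p r q -> 0 <= u q) ->
  e1 ^ 2 + e2 ^ 2 <= 1 -> (e1 * P p + e2 * Q p) * r <= 2 * u p.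
Proof.
  intros Hr0 Hpos He. set (D := e1 * P p + e2 * Q p).
  assert (HuC : C1 U u P Q) by apply Hu.
  set (W := fun q : pt => (e1 * (fst q - fst p) + e2 * (snd q - snd p)) * u q).
  assert (HW := C1_mult U _ _ _ _ _ _ openU (C1_lin U e1 e2 p) HuC).
  fold W in HW.
  assert (cu : forall q, U q -> cont u q) by (intros; eapply C1_cont; eauto).
  assert (cP : forall q, U q -> cont P q) by (intros; apply HuC; auto).
  assert (cQ : forall q, U q -> cont Q q) by (intros; apply HuC; auto).
  assert (flux : forall s, 0 < s < r -> RInt (radial
     (fun q => e1 * u q + (e1 * (fst q - fst p) + e2 * (snd q - snd p)) * P q)
     (fun q => e2 * u q + (e1 * (fst q - fst p) + e2 * (snd q - snd p)) * Q q) p s)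
     0 (2 * PI) = 2 * PI * s * D).
  { intros s Hs.
    assert (Fs : forall a, U (circ p s a)) by (intros; apply circ_in; lra).
    assert (As : Rabs s < r) by (apply Rabs_def1; lra).
    assert (IP := RInt_correct (V := R_CompleteNormedModule) _ _ _ (ex_cint U P p s r cP Hr As)).
    assert (IQ := RInt_correct (V := R_CompleteNormedModule) _ _ _ (ex_cint U Q p s r cQ Hr As)).
    fold (cint P p s) in IP. fold (cint Q p s) in IQ.
    rewrite mean_value_P in IP by lra. rewrite mean_value_Q in IQ by lra.
    (* The radial derivative of W equals s (e1 P + e2 Q) plus the angular derivative of g. The first
       part has known circle means and the second integrates to 0, so no second derivative of u is
       used. *)
    set (g := fun a => u (circ p s a) * (e1 * sin a - e2 * cos a)).
    set (g' := fun a => s * (Q (circ p s a) * cos a - P (circ p s a) * sin a) * (e1 * sin a - e2 * cos a)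
       + u (circ p s a) * (e1 * cos a + e2 * sin a)).
    assert (dg : forall a, is_derive g a (g' a)).
    { intros a. unfold g, g'.
      apply (is_derive_mult (fun a => u (circ p s a)) (fun a => e1 * sin a - e2 * cos a)).
      apply (circ_derive_a U u P Q); auto. auto_derive; auto. ring.
      intros; apply Rmult_comm. }
    assert (cg : forall a, continuous g' a).
    { intros a.
      assert (cc : continuous (fun a => P (circ p s a)) a) by apply cont_circ, cP, Fs.
      assert (cd : continuous (fun a => Q (circ p s a)) a) by apply cont_circ, cQ, Fs.
      assert (ce : continuous (fun a => u (circ p s a)) a) by apply cont_circ, cu, Fs.
      assert (ck : forall k l, continuous (fun a => k * sin a + l * cos a) a).
      { intros. apply (ex_derive_continuous (V := R_NormedModule)). auto_derive; auto. }
      apply continuous_ext with (f := fun a =>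
        s * (Q (circ p s a) * (0 * sin a + 1 * cos a) + P (circ p s a) * (-1 * sin a + 0 * cos a))
          * (e1 * sin a + (-e2) * cos a) + u (circ p s a) * (e2 * sin a + e1 * cos a)).
      { intros x. unfold g'. lazymatch goal with |- ?a = ?b => change (@eq R a b) end. ring. }
      apply continuous_Rplus.
      - apply continuous_Rmult; [apply continuous_Rmult; [apply continuous_const|]|apply ck].
        apply continuous_Rplus; apply continuous_Rmult; auto.
      - apply continuous_Rmult; auto. }
    assert (I0 : is_RInt g' 0 (2 * PI) 0).
    { evar_last. apply (is_RInt_derive g g'); auto.
      unfold g. rewrite circ_2PI, sin_2PI, cos_2PI, sin_0, cos_0.
      apply (minus_eq_zero (G := R_AbelianGroup)). }
    apply is_RInt_unique.
    eapply is_RInt_ext; [|evar_last; [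
      exact (is_RInt_plus _ _ _ _ _ _ (is_RInt_plus _ _ _ _ _ _
        (is_RInt_scal _ _ _ (s * e1) _ IP) (is_RInt_scal _ _ _ (s * e2) _ IQ)) I0) |]].
    - intros a _. unfold g', radial, circ, plus, scal; simpl. unfold mult; simpl.
      assert (E := sin2_cos2 a). unfold Rsqr in E.
      set (x := P _). set (y := Q _). set (z := u _).
      transitivity (s * e1 * x * (sin a * sin a + cos a * cos a) +
        s * e2 * y * (sin a * sin a + cos a * cos a) +
        (s * (y * cos a - x * sin a) * (e1 * sin a - e2 * cos a) + z * (e1 * cos a + e2 * sin a))).
      rewrite E; ring. ring.
    - unfold plus, scal; simpl. unfold mult, D; simpl. ring. }
  assert (main : forall s, 0 < s < r -> cint W p s = PI * s ^ 2 * D).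
  { intros s Hs.
    assert (E : cint W p s - PI * s ^ 2 * D = cint W p 0 - PI * 0 ^ 2 * D).
    { apply (eq_of_derive0 (fun s => cint W p s - PI * s ^ 2 * D)). lra.
      - intros x Hx. apply (continuous_minus (V := R_NormedModule)).
        apply (ex_derive_continuous (V := R_NormedModule)). eexists.
        eapply cint_derive; eauto. apply Rabs_def1; lra.
        apply (ex_derive_continuous (V := R_NormedModule)). auto_derive; auto.
      - intros x Hx. evar_last. apply (is_derive_minus (V := R_NormedModule)).
        eapply cint_derive; eauto. apply Rabs_def1; lra.
        instantiate (1 := 2 * PI * x * D). auto_derive; auto. ring.
        rewrite flux by lra. apply (minus_eq_zero (G := R_AbelianGroup)). }
    rewrite cint_0 in E. unfold W in E at 2. simpl in E. lra. }
  assert (bd : forall s, 0 < s < r -> D * s <= 2 * u p).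
  { intros s Hs. assert (As : Rabs s < r) by (apply Rabs_def1; lra).
    assert (X : PI * s ^ 2 * D <= s * (2 * PI * u p)).
    { rewrite <- main, <- (mean_value s) by lra. unfold cint.
      change (s * RInt (fun a => u (circ p s a)) 0 (2 * PI)) with
        (scal s (RInt (fun a => u (circ p s a)) 0 (2 * PI)) : R).
      rewrite <- (RInt_scal (V := R_CompleteNormedModule)) by (eapply ex_cint; eauto).
      apply RInt_le. assert (K := PI_RGT_0); lra.
      - apply (ex_cint U W p s r); auto. intros; eapply C1_cont; eauto.
      - apply (ex_RInt_scal (V := R_NormedModule)). eapply ex_cint; eauto.
      - intros a _. unfold W, scal; simpl. unfold mult; simpl.
        assert (u0 : 0 <= u (circ p s a)).
        { apply Hpos. unfold disc. rewrite circ_dist. exact As. }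
        assert (cs : e1 * cos a + e2 * sin a <= 1).
        { assert (E := sin2_cos2 a). unfold Rsqr in E.
          assert (A1 := pow2_ge_0 (e1 - cos a)). assert (A2 := pow2_ge_0 (e2 - sin a)). nra. }
        replace ((e1 * (fst p + s * cos a - fst p) + e2 * (snd p + s * sin a - snd p)) * u (circ p s a))
          with (s * u (circ p s a) * (e1 * cos a + e2 * sin a)) by ring.
        assert (0 <= s * u (circ p s a)) by (apply Rmult_le_pos; lra). nra. }
    assert (K := PI_RGT_0).
    apply Rmult_le_reg_l with (PI * s). apply Rmult_lt_0_compat; lra. nra. }
  apply Rnot_lt_le. intros C.
  assert (up : 0 <= u p). { apply Hpos. unfold disc. rewrite dist_refl. exact Hr0. }
  (* [bd] holds only for s < r. If D r > 2 u(p), the midpoint of 2 u(p) / D and r is a radius that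
     already violates it. *)
  assert (D0 : 0 < D) by nra.
  assert (C2 : 2 * u p / D < r).
  { apply Rmult_lt_reg_r with D. exact D0. unfold Rdiv. rewrite Rmult_assoc, Rinv_l; lra. }
  assert (C3 : 0 <= 2 * u p / D). { apply Rdiv_le_0_compat; lra. }
  assert (B := bd ((2 * u p / D + r) / 2) ltac:(lra)).
  replace (D * ((2 * u p / D + r) / 2)) with (u p + D * r / 2) in B by (field; lra).
  lra.
Qed.

End MeanValue.

(** Each point of the segment from p to z is the centre of a disc of radius r inside the disc of
    radius 2 r, so [grad_bound] gives |du/dt| <= 2 u along it. Hence u e^(2t) is nondecreasing. *)
Lemma harnack U u P Q p r z :
  is_open U -> harm U u P Q -> 0 < r ->
  (forall q, disc p (2 * r) q -> U q /\ 0 < u q) -> dist z p <= r ->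
  u p <= exp 2 * u z.
Proof.
  intros HU Hu Hr Hd Hz.
  set (x := fun t => fst p + t * (fst z - fst p)).
  set (y := fun t => snd p + t * (snd z - snd p)).
  assert (Hdist : forall t, 0 <= t <= 1 -> dist (x t, y t) p <= r).
  { intros t Ht. apply le_of_sq_le. lra. rewrite dist_sq. unfold x, y; simpl fst; simpl snd.
    assert (E := dist_sq z p). assert (E0 := dist_pos z p).
    assert (dist z p ^ 2 <= r ^ 2) by nra.
    replace ((fst p + t * (fst z - fst p) - fst p) ^ 2 + (snd p + t * (snd z - snd p) - snd p) ^ 2)
      with (t ^ 2 * dist z p ^ 2) by (rewrite E; ring).
    assert (0 <= t ^ 2 <= 1) by nra. assert (0 <= dist z p ^ 2) by nra. nra. }
  assert (Hin : forall t q, 0 <= t <= 1 -> disc (x t, y t) r q -> disc p (2 * r) q).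
  { intros t q Ht Hq. unfold disc in *. assert (T := dist_triangle q (x t, y t) p).
    assert (T2 := Hdist t Ht). lra. }
  assert (H0 : forall t, 0 <= t <= 1 -> disc p (2 * r) (x t, y t)).
  { intros t Ht. apply (Hin t); auto. unfold disc. rewrite dist_refl. exact Hr. }
  assert (HC : C1 U u P Q) by apply Hu.
  set (g := fun t => u (x t, y t) * exp (2 * t)).
  set (g' := fun t => (P (x t, y t) * (fst z - fst p) + Q (x t, y t) * (snd z - snd p)) * exp (2 * t)
     + u (x t, y t) * (2 * exp (2 * t))).
  assert (dg : forall t, 0 <= t <= 1 -> is_derive g t (g' t)).
  { intros t Ht. unfold g, g'.
    apply (is_derive_mult (fun t => u (x t, y t)) (fun t => exp (2 * t))).
    - apply (C1_comp U u P Q x y t); auto. apply Hd, H0, Ht.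
      unfold x; auto_derive; auto; ring. unfold y; auto_derive; auto; ring.
    - auto_derive; auto; ring.
    - intros; apply Rmult_comm. }
  assert (pos : forall t, 0 <= t <= 1 -> 0 <= g' t).
  { intros t Ht. unfold g'.
    (* The direction is (p - z) / r, of norm at most 1; the factor r of the estimate cancels the
       denominator. *)
    assert (B := grad_bound U u P Q (x t, y t) r HU Hu (fun q h => proj1 (Hd q (Hin t q Ht h)))
      (- (fst z - fst p) / r) (- (snd z - snd p) / r) Hr
      (fun q h => Rlt_le _ _ (proj2 (Hd q (Hin t q Ht h))))).
    assert (X : (- (fst z - fst p) / r) ^ 2 + (- (snd z - snd p) / r) ^ 2 <= 1).
    { replace ((- (fst z - fst p) / r) ^ 2 + (- (snd z - snd p) / r) ^ 2)
        with (dist z p ^ 2 / r ^ 2) by (rewrite dist_sq; field; lra).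
      assert (E0 := dist_pos z p).
      apply Rmult_le_reg_r with (r ^ 2). nra. unfold Rdiv. rewrite Rmult_assoc, Rinv_l by nra. nra. }
    specialize (B X).
    replace ((- (fst z - fst p) / r * P (x t, y t) + - (snd z - snd p) / r * Q (x t, y t)) * r)
      with (- (P (x t, y t) * (fst z - fst p) + Q (x t, y t) * (snd z - snd p))) in B
      by (field; lra).
    assert (E := exp_pos (2 * t)). nra. }
  assert (M : exists c, Rmin 0 1 <= c <= Rmax 0 1 /\ g 1 - g 0 = g' c * (1 - 0)).
  { apply (MVT_gen g 0 1 g'); rewrite Rmin_left, Rmax_right by lra.
    - intros t Ht. apply dg; lra.
    - intros t Ht. apply continuity_pt_filterlim.
      apply (ex_derive_continuous (V := R_NormedModule)). eexists. apply dg; lra. }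
  rewrite Rmin_left, Rmax_right in M by lra. destruct M as [c [Hc E]].
  assert (Pc := pos c Hc).
  unfold g in E. rewrite Rmult_0_r, exp_0 in E.
  replace (x 1, y 1) with z in E by (destruct z; unfold x, y; simpl; f_equal; ring).
  replace (x 0, y 0) with p in E by (destruct p; unfold x, y; simpl; f_equal; ring).
  replace (2 * 1) with 2 in E by ring. nra.
Qed.

(** * The logarithm as a harmonic function *)

(** The square keeps this polynomial. It serves twice: log |q - c| appears as half of
    [ln (sqd c q)], and [sqd] itself is the strictly subharmonic perturbation in [max_principle]. *)
Definition sqd (c q : pt) : R := (fst q - fst c) ^ 2 + (snd q - snd c) ^ 2.

Lemma cont_inv f p : cont f p -> f p <> 0 -> cont (fun q => / f q) p.
Proof.
  intros H H0. apply (continuous_comp (U := plane) (V := R_UniformSpace) f Rinv). exact H.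
  apply (continuous_Rinv (f p)). exact H0.
Qed.

Lemma cont_sqd c p : cont (sqd c) p.
Proof.
  apply continuous_ext with (f := fun q => (fst q + - fst c) * (fst q + - fst c) +
    (snd q + - snd c) * (snd q + - snd c)).
  intros q. unfold sqd. simpl. ring.
  apply cont_plus; apply cont_mult; apply cont_plus; try apply cont_const;
   (apply cont_fst || apply cont_snd).
Qed.

Definition punct (c : pt) : pset := fun q => 0 < sqd c q.

Lemma punct_open c : is_open (punct c).
Proof.
  intros p Hp. destruct (proj1 (cont_dist _ _) (cont_sqd c p) _ Hp) as [d [Hd H]].
  exists d; split; auto. intros q Hq. specialize (H q Hq). unfold punct.
  apply Rabs_def2 in H. lra.
Qed.

Lemma harm_log c :
  harm (punct c) (fun q => ln (sqd c q))
    (fun q => 2 * (fst q - fst c) * / sqd c q)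
    (fun q => 2 * (snd q - snd c) * / sqd c q).
Proof.
  assert (cx : forall k p, cont (fun q => k * (fst q - fst c)) p).
  { intros. apply cont_mult. apply cont_const. apply cont_plus. apply cont_fst. apply cont_const. }
  assert (cy : forall k p, cont (fun q => k * (snd q - snd c)) p).
  { intros. apply cont_mult. apply cont_const. apply cont_plus. apply cont_snd. apply cont_const. }
  assert (ci : forall p, punct c p -> cont (fun q => / sqd c q) p).
  { intros p Hp. apply cont_inv. apply cont_sqd. apply Rgt_not_eq, Hp. }
  (* With c at the origin the Hessian entries are 2 (y^2 - x^2) / |z|^4 and -4 x y / |z|^4. They are
     factored into multiples of one coordinate, to which [cx], [cy] and [cont_mult] apply; the
     square roots split the coefficient 2. *)
  split; [|exists (fun q => ((sqrt 2 * (snd q - snd c)) * (sqrt 2 * (snd q - snd c))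
      + (- sqrt 2 * (fst q - fst c)) * (sqrt 2 * (fst q - fst c))) * (/ sqd c q * / sqd c q)),
      (fun q => (- 4 * (fst q - fst c)) * (1 * (snd q - snd c)) * (/ sqd c q * / sqd c q))].
  - intros p Hp. unfold punct in Hp. repeat split.
    + apply is_derive_Reals. unfold sqd in *; simpl fst in *; simpl snd in *.
      auto_derive. exact Hp. field. lra.
    + apply is_derive_Reals. unfold sqd in *; simpl fst in *; simpl snd in *.
      auto_derive. exact Hp. field. lra.
    + apply cont_mult; auto.
    + apply cont_mult; auto.
  - assert (s2 : sqrt 2 * sqrt 2 = 2) by (apply sqrt_sqrt; lra).
    split; intros p Hp; repeat split.
    + apply is_derive_Reals. unfold punct, sqd in *; simpl fst in *; simpl snd in *.
      auto_derive. lra.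
      transitivity ((sqrt 2 * sqrt 2) * ((snd p - snd c) ^ 2 - (fst p - fst c) ^ 2) *
        (/ ((fst p - fst c) ^ 2 + (snd p - snd c) ^ 2) * / ((fst p - fst c) ^ 2 + (snd p - snd c) ^ 2))).
      rewrite s2. field. lra. ring.
    + apply is_derive_Reals. unfold punct, sqd in *; simpl fst in *; simpl snd in *.
      auto_derive. lra. field. lra.
    + apply cont_mult; [apply cont_plus; apply cont_mult; auto | apply cont_mult; auto].
    + apply cont_mult; [apply cont_mult; auto | apply cont_mult; auto].
    + apply is_derive_Reals. unfold punct, sqd in *; simpl fst in *; simpl snd in *.
      auto_derive. lra. field. lra.
    + apply is_derive_Reals. unfold punct, sqd in *; simpl fst in *; simpl snd in *.
      auto_derive. lra.
      transitivity (- ((sqrt 2 * sqrt 2) * ((snd p - snd c) ^ 2 - (fst p - fst c) ^ 2) *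
        (/ ((fst p - fst c) ^ 2 + (snd p - snd c) ^ 2) * / ((fst p - fst c) ^ 2 + (snd p - snd c) ^ 2)))).
      rewrite s2. field. lra. ring.
    + apply cont_mult; [apply cont_mult; auto | apply cont_mult; auto].
    + apply (continuous_opp (V := R_NormedModule)).
      apply cont_mult; [apply cont_plus; apply cont_mult; auto | apply cont_mult; auto].
Qed.

(** * Maximum principle *)

Lemma list_argmax (A : Type) (f : A -> R) (l : list A) : l <> nil ->
  exists x, In x l /\ forall y, In y l -> f y <= f x.
Proof.
  induction l as [|a l IH]; intros H. congruence.
  destruct (classic (l = nil)) as [->|Hl].
  - exists a. split. left; auto. intros y [->|[]]; lra.
  - destruct (IH Hl) as [x [Hx Hm]]. destruct (Rle_dec (f x) (f a)).
    + exists a. split. left; auto. intros y [->|Hy]. lra. specialize (Hm y Hy). lra.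
    + exists x. split. right; auto. intros y [->|Hy]. lra. auto.
Qed.

Definition closed_set (K : pset) : Prop := is_open (fun q => ~ K q).

(** If no maximum exists, every point t of the plane has a neighbourhood on which all values over K
    are beaten by one value f(z), with z in K. Finitely many neighbourhoods cover K, and the largest
    of the finitely many f(z) would have to be beaten too. *)
Lemma attains_max (K : pset) (f : pt -> R) (c : pt) (B : R) :
  closed_set K -> (forall p, K p -> dist p c <= B) -> continuous_on K f ->
  (exists p, K p) -> exists p, K p /\ forall q, K q -> f q <= f p.
Proof.
  intros Kc Kb Kf [p0 Hp0]. apply NNPP. intros C.
  assert (H : forall t : pt, exists dz : posreal * pt, K (snd dz) /\
    forall q, K q -> dist q t < fst dz -> f q < f (snd dz)).
  { intros t. destruct (classic (K t)) as [Ht|Ht].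
    - assert (X : exists z, K z /\ f t < f z).
      { apply NNPP. intros X. apply C. exists t. split; auto. intros q Hq.
        apply Rnot_lt_le. intros Y. apply X. exists q; auto. }
      destruct X as [z [Hz Hl]].
      destruct (Kf t Ht (f z - f t)) as [d [Hd Hc]]. lra.
      exists (mkposreal d Hd, z). simpl. split; auto. intros q Hq Hd'.
      specialize (Hc q Hq Hd'). apply Rabs_def2 in Hc. lra.
    (* Off K the neighbourhood misses K altogether, and [p0] is a placeholder. *)
    - destruct (Kc t Ht) as [d [Hd Hc]]. exists (mkposreal d Hd, p0). simpl.
      split; auto. intros q Hq Hd'. exfalso. apply (Hc q); auto. }
  set (F := fun t => proj1_sig (constructive_indefinite_description _ (H t))).
  assert (HF : forall t, K (snd (F t)) /\
    forall q, K q -> dist q t < fst (F t) -> f q < f (snd (F t))).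
  { intros t. unfold F. destruct (constructive_indefinite_description _ (H t)); auto. }
  clearbody F.
  (* The finite cover is only provided under a double negation, which is enough since the goal is
     [False]. It consists of squares; half the radius in each coordinate keeps the Euclidean
     distance below the full radius. *)
  apply (Compactness.compactness_list 2
    (fst c - B, (snd c - B, tt)) (fst c + B, (snd c + B, tt))
    (fun t => pos_div_2 (fst (F (fst t, fst (snd t)))))).
  intros [l Hl].
  assert (Hcov : forall q, K q -> exists t, In t l /\ f q < f (snd (F (fst t, fst (snd t))))).
  { intros q Hq. destruct (abs_le_dist q c) as [A1 A2]. specialize (Kb q Hq).
    destruct (Hl (fst q, (snd q, tt))) as [[a [b []]] [Ht [_ [C1' [C2' _]]]]].
    { simpl. assert (E1 := Rle_trans _ _ _ A1 Kb). assert (E2 := Rle_trans _ _ _ A2 Kb).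
      apply Rabs_le_between in E1, E2. repeat split; lra. }
    exists (a, (b, tt)). split; auto. simpl in *. apply HF; auto.
    assert (E := dist_le_abs q (a, b)). simpl in E. lra. }
  destruct (list_argmax _ (fun t => f (snd (F (fst t, fst (snd t))))) l) as [t [Ht Hm]].
  { intros ->. destruct (Hcov p0 Hp0) as [t [[] _]]. }
  destruct (Hcov (snd (F (fst t, fst (snd t))))) as [t' [Ht' Hlt]]. apply HF.
  specialize (Hm t' Ht'). simpl in Hm. lra.
Qed.

Lemma cw_cont K f p : cont f p -> continuous_within K f p.
Proof.
  intros H e He. destruct (proj1 (cont_dist f p) H e He) as [d [Hd Hq]].
  exists d; split; auto.
Qed.

Lemma cw_sub (K S : pset) f p : (forall q, K q -> S q) ->
  continuous_within S f p -> continuous_within K f p.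
Proof.
  intros H Hf e He. destruct (Hf e He) as [d [Hd Hq]]. exists d; split; auto.
Qed.

Lemma cw_lin K f g a b p : continuous_within K f p -> continuous_within K g p ->
  continuous_within K (fun q => a * f q + b * g q) p.
Proof.
  intros Hf Hg e He. set (A := Rabs a + Rabs b + 1).
  assert (Ha := Rabs_pos a). assert (Hb := Rabs_pos b).
  assert (HA : 0 < e / A) by (apply Rdiv_lt_0_compat; unfold A; lra).
  destruct (Hf _ HA) as [d [Hd Hq]], (Hg _ HA) as [d' [Hd' Hq']].
  exists (Rmin d d'). split. apply Rmin_pos; auto. intros q HK Hdist.
  assert (X := Hq q HK (Rlt_le_trans _ _ _ Hdist (Rmin_l _ _))).
  assert (Y := Hq' q HK (Rlt_le_trans _ _ _ Hdist (Rmin_r _ _))).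
  replace (a * f q + b * g q - (a * f p + b * g p))
    with (a * (f q - f p) + b * (g q - g p)) by ring.
  eapply Rle_lt_trans. apply Rabs_triang. rewrite !Rabs_mult.
  assert (E : e = A * (e / A)) by (field; unfold A; lra).
  rewrite E at 1. set (h := e / A) in *. unfold A.
  assert (Rabs a * Rabs (f q - f p) <= Rabs a * h) by (apply Rmult_le_compat_l; lra).
  assert (Rabs b * Rabs (g q - g p) <= Rabs b * h) by (apply Rmult_le_compat_l; lra).
  lra.
Qed.

(** The form of harmonicity used by both maximum principles. It needs no derivatives and passes to
    linear combinations, so u, its partial derivatives and the logarithm can be mixed freely. *)
Definition MVP (U : pset) (v : pt -> R) : Prop :=
  (forall p, U p -> cont v p) /\
  forall p r s, (forall q, disc p r q -> U q) -> 0 <= s < r ->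
    cint v p s = 2 * PI * v p.

Lemma MVP_harm U u P Q : is_open U -> harm U u P Q ->
  MVP U u /\ MVP U P /\ MVP U Q.
Proof.
  intros HU H. repeat split.
  - intros. eapply C1_cont; eauto. apply H.
  - intros. eapply mean_value; eauto.
  - intros p Hp. apply H, Hp.
  - intros. eapply mean_value_P; eauto.
  - intros p Hp. apply H, Hp.
  - intros. eapply mean_value_Q; eauto.
Qed.

Lemma MVP_sub (U V : pset) v : (forall p, V p -> U p) -> MVP U v -> MVP V v.
Proof. intros H [Hc Hm]. split; auto. intros. eapply Hm; eauto. Qed.

Lemma MVP_lin U f g a b : MVP U f -> MVP U g -> MVP U (fun q => a * f q + b * g q).
Proof.
  intros [Hf Mf] [Hg Mg]. split.
  - intros p Hp. apply cont_plus; apply cont_mult; auto; apply cont_const.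
  - intros p r s Hr Hs. assert (As : Rabs s < r) by (apply Rabs_def1; lra).
    assert (If := RInt_correct (V := R_CompleteNormedModule) _ _ _ (ex_cint U f p s r Hf Hr As)).
    assert (Ig := RInt_correct (V := R_CompleteNormedModule) _ _ _ (ex_cint U g p s r Hg Hr As)).
    fold (cint f p s) in If. fold (cint g p s) in Ig.
    rewrite (Mf p r s Hr Hs) in If. rewrite (Mg p r s Hr Hs) in Ig.
    apply is_RInt_unique. evar_last.
    + exact (is_RInt_plus _ _ _ _ _ _ (is_RInt_scal _ _ _ a _ If) (is_RInt_scal _ _ _ b _ Ig)).
    + unfold plus, scal; simpl. unfold mult; simpl. ring.
Qed.

(* Adding a small multiple of |z|^2 makes the mean value inequality strict at an interior maximum. *)
Lemma max_principle (K V : pset) (v : pt -> R) (M : R) (c : pt) (B : R) :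
  closed_set K -> (forall p, K p -> dist p c <= B) -> continuous_on K v ->
  is_open V -> (forall p, V p -> K p) -> MVP V v ->
  (forall p, K p -> ~ V p -> v p <= M) ->
  forall p, K p -> v p <= M.
Proof.
  intros Kc Kb Kv HV VK [cv Mv] Hb p0 Hp0. apply Rnot_lt_le. intros Hlt.
  assert (B0 : 0 <= B) by (eapply Rle_trans; [apply (dist_pos p0 c)|auto]).
  (* Small enough that ep B^2 < v(p0) - M, so the perturbed maximum cannot lie where v <= M. *)
  set (ep := (v p0 - M) / (B ^ 2 + 1)).
  assert (B2 : 0 <= B ^ 2) by apply pow2_ge_0.
  assert (Hep : 0 < ep) by (apply Rdiv_lt_0_compat; lra).
  assert (Eep : ep * (B ^ 2 + 1) = v p0 - M) by (unfold ep; field; lra).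
  destruct (attains_max K (fun q => 1 * v q + ep * sqd c q) c B) as [z [Kz Hz]]; auto.
  { intros q Hq. apply cw_lin; auto. apply cw_cont, cont_sqd. }
  { exists p0; auto. }
  simpl in Hz.
  assert (Sq : forall q, sqd c q = dist q c ^ 2) by (intros; rewrite dist_sq; reflexivity).
  destruct (classic (V z)) as [Vz|Vz].
  - destruct (HV z Vz) as [r [Hr Hd]].
    assert (As : Rabs (r / 2) < r) by (apply Rabs_def1; lra).
    assert (m := Mv z r (r / 2) Hd ltac:(lra)).
    set (s := r / 2) in *.
    assert (Hin : forall a, V (circ z s a)) by (intros; apply Hd; rewrite circ_dist; auto).
    (* Maximality of v + ep |q - c|^2 at z, solved for v on the circle of radius s, bounds v by g'.
       The trigonometric terms integrate to 0, so the mean of v is at most v(z) - ep s^2. *)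
    set (g' := fun a => v z - ep * s ^ 2 - 2 * ep * s *
      ((fst z - fst c) * cos a + (snd z - snd c) * sin a)).
    set (g := fun a => (v z - ep * s ^ 2) * a - 2 * ep * s *
      ((fst z - fst c) * sin a - (snd z - snd c) * cos a)).
    assert (Ig : is_RInt g' 0 (2 * PI) (2 * PI * (v z - ep * s ^ 2))).
    { evar_last. apply (is_RInt_derive g g').
      - intros a _. unfold g, g'. auto_derive; auto. ring.
      - intros a _. apply (ex_derive_continuous (V := R_NormedModule)). unfold g'.
        auto_derive; auto.
      - unfold minus, plus, opp, g; simpl. rewrite cos_2PI, sin_2PI, cos_0, sin_0. ring. }
    assert (Lv : cint v z s <= 2 * PI * (v z - ep * s ^ 2)).
    { rewrite <- (is_RInt_unique _ _ _ _ Ig). unfold cint. assert (K0 := PI_RGT_0).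
      apply RInt_le. lra.
      - eapply ex_cint; [exact cv|exact Hd|exact As].
      - eexists; exact Ig.
      - intros a _. specialize (Hz (circ z s a) (VK _ (Hin a))).
        unfold sqd, circ in Hz; simpl fst in Hz; simpl snd in Hz. unfold g', circ.
        assert (E := sin2_cos2 a). unfold Rsqr in E.
        assert (E2 : ep * (s ^ 2 * (sin a * sin a + cos a * cos a)) = ep * s ^ 2) by (rewrite E; ring).
        ring_simplify in Hz. ring_simplify in E2. ring_simplify. lra. }
    rewrite m in Lv. assert (K0 := PI_RGT_0). assert (0 < s) by (unfold s; lra).
    assert (0 < ep * s ^ 2) by (apply Rmult_lt_0_compat; nra). nra.
  - specialize (Hb z Kz Vz). specialize (Hz p0 Hp0). rewrite !Sq in Hz.
    assert (Z1 := Kb z Kz). assert (Z2 := dist_pos z c).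
    assert (dist z c ^ 2 <= B ^ 2) by nra. assert (0 <= dist p0 c ^ 2) by apply pow2_ge_0.
    nra.
Qed.

(** * From the definitions to gradients of class C^1 *)

Lemma partial_ext (U : pset) f g p l l' : is_open U -> U p ->
  (forall q, U q -> f q = g q) -> partial_x f p l -> partial_y f p l' ->
  partial_x g p l /\ partial_y g p l'.
Proof.
  intros HU Hp E H1 H2. destruct (HU p Hp) as [d [Hd Hq]].
  assert (D1 : forall t : R, Rabs (t - fst p) < d -> U (t, snd p)).
  { intros t Ht. apply Hq. eapply Rle_lt_trans. apply dist_le_abs. simpl.
    replace (snd p - snd p) with 0 by ring. rewrite Rabs_R0. lra. }
  assert (D2 : forall t : R, Rabs (t - snd p) < d -> U (fst p, t)).
  { intros t Ht. apply Hq. eapply Rle_lt_trans. apply dist_le_abs. simpl.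
    replace (fst p - fst p) with 0 by ring. rewrite Rabs_R0. lra. }
  split; apply is_derive_Reals.
  - eapply is_derive_ext_loc; [|apply is_derive_Reals, H1].
    exists (mkposreal d Hd). intros t Ht. apply E, D1, Ht.
  - eapply is_derive_ext_loc; [|apply is_derive_Reals, H2].
    exists (mkposreal d Hd). intros t Ht. apply E, D2, Ht.
Qed.

Lemma partial_x_unique f p l l' : partial_x f p l -> partial_x f p l' -> l = l'.
Proof. apply uniqueness_limite. Qed.

Lemma partial_y_unique f p l l' : partial_y f p l -> partial_y f p l' -> l = l'.
Proof. apply uniqueness_limite. Qed.

Lemma mixed_partials (U : pset) f fx fy fxx fxy fyx fyy p : is_open U ->
  (forall q, U q -> partial_x f q (fx q) /\ partial_y f q (fy q)) ->
  C1 U fx fxx fxy -> C1 U fy fyx fyy -> U p -> fyx p = fxy p.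
Proof.
  intros HU H Hx Hy Hp.
  assert (dx : forall q, U q -> Derive (fun t => f (t, snd q)) (fst q) = fx q).
  { intros. apply is_derive_unique, is_derive_Reals, H; auto. }
  assert (dy : forall q, U q -> Derive (fun t => f (fst q, t)) (snd q) = fy q).
  { intros. apply is_derive_unique, is_derive_Reals, H; auto. }
  assert (Dyx : forall q, U q ->
    is_derive (fun z => Derive (fun t => f (z, t)) (snd q)) (fst q) (fyx q)).
  { intros q Hq. apply is_derive_Reals.
    apply (partial_ext U fy (fun q => Derive (fun t => f (fst q, t)) (snd q)) q (fyx q) (fyy q));
      auto. intros; symmetry; auto. apply Hy, Hq. apply Hy, Hq. }
  assert (Dxy : forall q, U q ->
    is_derive (fun z => Derive (fun t => f (t, z)) (fst q)) (snd q) (fxy q)).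
  { intros q Hq. apply is_derive_Reals.
    apply (partial_ext U fx (fun q => Derive (fun t => f (t, snd q)) (fst q)) q (fxx q) (fxy q));
      auto. intros; symmetry; auto. apply Hx, Hq. apply Hx, Hq. }
  assert (LU : locally_2d (fun a b => U (a, b)) (fst p) (snd p)).
  { apply locally_2d_locally. destruct p as [a b]. simpl.
    generalize (open_locally U (a, b) HU Hp). apply filter_imp. intros [x y]; auto. }
  rewrite <- (is_derive_unique _ _ _ (Dyx p Hp)), <- (is_derive_unique _ _ _ (Dxy p Hp)).
  apply (Schwarz (fun a b => f (a, b))).
  - destruct LU as [d Hd]. exists d. intros a b Ha Hb. specialize (Hd a b Ha Hb).
    repeat split; eexists.
    + apply is_derive_Reals, (H _ Hd).
    + apply is_derive_Reals, (H _ Hd).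
    + apply (Dyx _ Hd).
    + apply (Dxy _ Hd).
  - apply continuity_2d_pt_ext_loc with (f := fun a b => fyx (a, b)).
    + destruct LU as [d Hd]. exists d. intros a b Ha Hb. symmetry.
      apply is_derive_unique, (Dyx (a, b)), Hd; auto.
    + apply continuity_2d_pt_filterlim. destruct p as [a b].
      change (cont (fun z => fyx (fst z, snd z)) (a, b)).
      apply (continuous_ext (T := plane) (U := R_UniformSpace) fyx); [|apply (Hy _ Hp)].
      intros [x y]; reflexivity.
  - apply continuity_2d_pt_ext_loc with (f := fun a b => fxy (a, b)).
    + destruct LU as [d Hd]. exists d. intros a b Ha Hb. symmetry.
      apply is_derive_unique, (Dxy (a, b)), Hd; auto.
    + apply continuity_2d_pt_filterlim. destruct p as [a b].
      change (cont (fun z => fxy (fst z, snd z)) (a, b)).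
      apply (continuous_ext (T := plane) (U := R_UniformSpace) fxy); [|apply (Hx _ Hp)].
      intros [x y]; reflexivity.
Qed.

(** The hypotheses give three versions of the gradient: one from [Ck], one from the Laplace
    equation, and gx, gy, which extend to the closure. Uniqueness of partial derivatives identifies
    them, and Schwarz gives the symmetric Hessian. *)
Lemma harm_of_harmonic_on (U : pset) u gx gy : is_open U -> harmonic_on U u ->
  (forall p, U p -> partial_x u p (gx p) /\ partial_y u p (gy p)) ->
  (forall p, U p -> cont gx p /\ cont gy p) ->
  harm U u gx gy.
Proof.
  intros HU [[_ [fx [fy [Hf [[_ [fxx [fxy [Hfx [cxx cxy]]]]] [_ [fyx [fyy [Hfy [cyx cyy]]]]]]]]]]
    [ux [uy [Hu Hl]]]] Hg Hc.
  assert (Cx : C1 U fx fxx fxy).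
  { intros q Hq. split; [|split; [|split]]; try apply Hfx; auto; eapply cont_of_on; eauto. }
  assert (Cy : C1 U fy fyx fyy).
  { intros q Hq. split; [|split; [|split]]; try apply Hfy; auto; eapply cont_of_on; eauto. }
  assert (mix : forall q, U q -> fyx q = fxy q).
  { intros q Hq. apply (mixed_partials U u fx fy fxx fxy fyx fyy); auto. }
  assert (lap : forall q, U q -> fyy q = - fxx q).
  { intros q Hq. destruct (Hl q Hq) as [a [b [Ha [Hb E]]]].
    assert (a = fxx q).
    { eapply partial_x_unique; [exact Ha|].
      apply (partial_ext U fx ux q (fxx q) (fxy q)); auto; try apply Hfx; auto.
      intros z Hz. eapply partial_x_unique; [apply Hf|apply Hu]; auto. }
    assert (b = fyy q).
    { eapply partial_y_unique; [exact Hb|].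
      apply (partial_ext U fy uy q (fyx q) (fyy q)); auto; try apply Hfy; auto.
      intros z Hz. eapply partial_y_unique; [apply Hf|apply Hu]; auto. }
    lra. }
  split.
  - intros q Hq. destruct (Hg q Hq), (Hc q Hq). auto.
  - exists fxx, fxy. split; intros q Hq.
    + destruct (partial_ext U fx gx q (fxx q) (fxy q)) as [A A']; auto; try apply Hfx; auto.
      intros z Hz. eapply partial_x_unique; [apply Hf|apply Hg]; auto.
      split; [|split; [|split]]; auto; apply Cx; auto.
    + destruct (partial_ext U fy gy q (fyx q) (fyy q)) as [A A']; auto; try apply Hfy; auto.
      intros z Hz. eapply partial_y_unique; [apply Hf|apply Hg]; auto.
      rewrite mix in A by auto. rewrite lap in A' by auto.
      split; [|split; [|split]]; auto. apply Cx; auto.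
      apply (continuous_opp (V := R_NormedModule)). apply Cx; auto.
Qed.

(** * Closures, segments and nearest boundary points *)

Lemma subset_closure (S : pset) p : S p -> closure S p.
Proof. intros H e He. exists p. rewrite dist_refl. auto. Qed.

Lemma closure_closed (S : pset) : closed_set (closure S).
Proof.
  intros p Hp. apply not_all_ex_not in Hp. destruct Hp as [e He].
  apply imply_to_and in He. destruct He as [He Hn].
  exists (e / 2). split. lra. intros q Hq Hc.
  destruct (Hc (e / 2) ltac:(lra)) as [z [Hz Hd]]. apply Hn. exists z. split; auto.
  assert (T := dist_triangle p q z). rewrite (dist_sym p q) in T. lra.
Qed.

Lemma closure_boundary (S : pset) p : closure S p -> ~ S p -> boundary S p.
Proof. intros H Hn. split; auto. apply subset_closure, Hn. Qed.

Lemma closed_inter_ball (S : pset) c r : closed_set S ->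
  closed_set (fun q => S q /\ dist q c <= r).
Proof.
  intros H p Hp. destruct (classic (S p)) as [Sp|Sp].
  - assert (Hr : r < dist p c) by (apply Rnot_le_lt; intros X; apply Hp; auto).
    exists (dist p c - r). split. lra. intros q Hq [_ Hd].
    assert (T := dist_triangle p q c). rewrite (dist_sym p q) in T. lra.
  - destruct (H p Sp) as [d [Hd Hq]]. exists d. split; auto. intros q Hq' [Sq _].
    apply (Hq q); auto.
Qed.

Lemma cont_dist_to c p : cont (fun q => dist q c) p.
Proof.
  apply cont_dist. intros e He. exists e. split; auto. intros q Hq.
  assert (T := dist_triangle q p c). assert (T' := dist_triangle p q c).
  rewrite (dist_sym p q) in T'. apply Rabs_def1; lra.
Qed.

Definition seg (q p : pt) (t : R) : pt :=
  (fst q + t * (fst p - fst q), snd q + t * (snd p - snd q)).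

Lemma seg_dist_l q p t : 0 <= t -> dist (seg q p t) q = t * dist q p.
Proof.
  intros Ht. assert (X := dist_sq (seg q p t) q). assert (Y := dist_sq q p).
  assert (Z := dist_pos (seg q p t) q). assert (Z' := dist_pos q p).
  unfold seg in X at 2 3; simpl fst in X; simpl snd in X.
  assert (W : dist (seg q p t) q ^ 2 = (t * dist q p) ^ 2).
  { rewrite X, Rpow_mult_distr, Y. ring. }
  apply Rle_antisym; apply le_of_sq_le; nra.
Qed.

Lemma seg_dist_r q p t : t <= 1 -> dist (seg q p t) p = (1 - t) * dist q p.
Proof.
  intros Ht. rewrite (dist_sym q p), <- (seg_dist_l p q) by lra. f_equal.
  unfold seg. f_equal; ring.
Qed.

Lemma nearest_boundary_point (Om : pset) p : is_open Om -> Om p -> (exists q, ~ Om q) ->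
  exists q, boundary Om q /\ ~ Om q /\ 0 < dist q p /\ forall z, disc p (dist q p) z -> Om z.
Proof.
  intros HO Hp [q0 Hq0].
  (* A nearest point of the complement maximises minus the distance. Cutting with the ball through
     q0 makes the set bounded, and [+ 0 * 0] gives the function the shape expected by [cw_lin]. *)
  destruct (attains_max (fun q => ~ Om q /\ dist q p <= dist q0 p) (fun q => -1 * dist q p + 0 * 0) p (dist q0 p))
    as [q [[Hq Hd] Hm]].
  - apply closed_inter_ball. intros z Hz. apply NNPP in Hz.
    destruct (HO z Hz) as [d [Hd H]]. exists d. split; auto. 
  - tauto.
  - intros z _. apply (cw_lin _ (fun q => dist q p) (fun _ => 0)); apply cw_cont.
    apply cont_dist_to. apply cont_const.
  - exists q0. split; auto. lra.
  - assert (Hpos : 0 < dist q p).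
    { destruct (Rle_lt_or_eq_dec _ _ (dist_pos q p)) as [|E]; auto.
      symmetry in E. apply dist_eq0 in E. congruence. }
    assert (Hin : forall z, disc p (dist q p) z -> Om z).
    { intros z Hz. unfold disc in Hz. apply NNPP. intros Nz.
      assert (Hz' : dist z p <= dist q0 p) by lra.
      specialize (Hm z (conj Nz Hz')). cbv beta in Hm. lra. }
    exists q. split; [|auto]. apply closure_boundary; auto.
    (* The segment from q to p enters the disc at once, so it supplies points of Om within e of
       q. *)
    intros e He. set (t := Rmin 1 (e / dist q p) / 2).
    assert (e1 : 0 < e / dist q p) by (apply Rdiv_lt_0_compat; lra).
    assert (t1 : 0 < t < 1 /\ t < e / dist q p).
    { unfold t. assert (0 < Rmin 1 (e / dist q p)) by (apply Rmin_pos; lra).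
      assert (A1 := Rmin_l 1 (e / dist q p)). assert (A2 := Rmin_r 1 (e / dist q p)). lra. }
    assert (Z1 : dist q (seg q p t) = t * dist q p).
    { rewrite dist_sym. apply seg_dist_l. lra. }
    assert (Z2 : dist (seg q p t) p = (1 - t) * dist q p) by (apply seg_dist_r; lra).
    exists (seg q p t). split.
    + apply Hin. unfold disc. nra.
    + rewrite Z1. apply Rmult_lt_reg_r with (/ dist q p). apply Rinv_0_lt_compat; auto.
      rewrite Rmult_assoc, Rinv_r by lra. unfold Rdiv in t1. lra.
Qed.

(** * Gradient bounds *)

Definition along (e1 e2 : R) (gx gy : pt -> R) (p : pt) : R := e1 * gx p + e2 * gy p.

Lemma along_le e1 e2 x y k : 0 <= k -> e1 ^ 2 + e2 ^ 2 <= k ^ 2 -> x ^ 2 + y ^ 2 <= 1 ->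
  e1 * x + e2 * y <= k.
Proof.
  intros Hk He Hx. apply le_of_sq_le; auto.
  assert (0 <= (e1 * y - e2 * x) ^ 2) by apply pow2_ge_0.
  assert ((e1 * x + e2 * y) ^ 2 = (e1 ^ 2 + e2 ^ 2) * (x ^ 2 + y ^ 2) - (e1 * y - e2 * x) ^ 2) by ring.
  assert (0 <= x ^ 2 + y ^ 2) by (assert (A := pow2_ge_0 x); assert (B := pow2_ge_0 y); lra).
  assert (0 <= e1 ^ 2 + e2 ^ 2) by (assert (A := pow2_ge_0 e1); assert (B := pow2_ge_0 e2); lra).
  nra.
Qed.

Lemma ln_sqd c q : 0 < dist q c -> ln (sqd c q) = 2 * ln (dist q c).
Proof.
  intros H. unfold sqd. rewrite <- dist_sq.
  replace (dist q c ^ 2) with (dist q c * dist q c) by ring. rewrite ln_mult by auto. ring.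
Qed.

Lemma MVP_ln c : MVP (punct c) (fun q => ln (sqd c q)).
Proof. apply (MVP_harm _ _ _ _ (punct_open c) (harm_log c)). Qed.

Lemma punct_dist c q : 0 < dist q c -> punct c q.
Proof. intros H. unfold punct, sqd. rewrite <- dist_sq. apply pow_lt, H. Qed.

(** Makes the logarithmic barrier grow at least linearly in from the outer circle. *)
Lemma ln_lower t : 0 <= t < 1 -> t <= - ln (1 - t).
Proof.
  intros Ht. assert (H : ln (1 - t) <= - t); [|lra].
  rewrite <- (ln_exp (- t)). apply ln_le. lra.
  destruct (Req_dec t 0) as [->|Hn]. rewrite Ropp_0, exp_0; lra.
  assert (X := exp_ineq1 (- t)). lra.
Qed.

Lemma ln2_bounds : 0 < ln 2 <= 1.
Proof.
  split. rewrite <- ln_1. apply ln_increasing; lra.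
  assert (X := exp_ineq1 1). rewrite <- (ln_exp 1). apply ln_le; lra.
Qed.

(* The barrier is m ln(d/|z-p|)/ln 2, stated with denominators cleared. *)
Lemma annulus_barrier (u P Q : pt -> R) (p : pt) d m z :
  0 < d -> 0 <= m -> harm (disc p d) u P Q ->
  (forall q, dist q p <= d -> 0 <= u q) ->
  (forall q, dist q p <= d -> continuous_within (fun q => dist q p <= d) u q) ->
  (forall q, dist q p = d / 2 -> m <= u q) ->
  d / 2 <= dist z p <= d -> m * (ln d - ln (dist z p)) <= ln 2 * u z.
Proof.
  intros Hd Hm Hh Hpos Hc Hin Hz.
  set (K := fun q => d / 2 <= dist q p /\ dist q p <= d).
  set (V := fun q => d / 2 < dist q p /\ dist q p < d).
  set (v := fun q => - m / 2 * ln (sqd p q) + - ln 2 * u q).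
  assert (Vo : is_open V).
  { intros q [H1 H2]. exists (Rmin (dist q p - d / 2) (d - dist q p)). split.
    apply Rmin_pos; lra. intros w Hw.
    assert (A1 := Rmin_l (dist q p - d / 2) (d - dist q p)).
    assert (A2 := Rmin_r (dist q p - d / 2) (d - dist q p)).
    assert (T := dist_triangle w q p). assert (T' := dist_triangle q w p).
    rewrite (dist_sym q w) in T'. split; lra. }
  assert (M : forall q, K q -> v q <= - m * ln d).
  { assert (L2 := ln2_bounds).
    apply (max_principle K V v (- m * ln d) p d).
    - unfold K. apply (closed_inter_ball (fun q => d / 2 <= dist q p)).
      intros q Hq. apply Rnot_le_lt in Hq. exists (d / 2 - dist q p). split. lra.
      intros w Hw Hk. assert (T := dist_triangle w q p). lra.
    - intros q [_ H]; exact H.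
    - intros q [H1 H2]. unfold v. apply cw_lin.
      + apply cw_cont. apply (MVP_ln p). apply punct_dist. lra.
      + apply (cw_sub _ (fun q => dist q p <= d)). intros w [_ H]; exact H. auto.
    - exact Vo.
    - intros q [H1 H2]; split; lra.
    - apply MVP_lin.
      + eapply MVP_sub; [|apply MVP_ln]. intros q [H1 H2]. apply punct_dist. lra.
      + eapply MVP_sub; [|apply (MVP_harm (disc p d) u P Q); auto; apply disc_open].
        intros q [H1 H2]. exact H2.
    - intros q [H1 H2] Hn. unfold v. rewrite ln_sqd by lra.
      assert (u0 := Hpos q H2).
      destruct (Req_dec (dist q p) (d / 2)) as [E|E].
      + specialize (Hin q E). rewrite E.
        replace (ln (d / 2)) with (ln d - ln 2) by (symmetry; apply ln_div; lra).
        assert (ln 2 * m <= ln 2 * u q) by (apply Rmult_le_compat_l; lra). lra.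
      + assert (E' : dist q p = d).
        { apply Rle_antisym; auto. apply Rnot_lt_le. intros X. apply Hn. split; lra. }
        rewrite E'. assert (0 <= ln 2 * u q) by (apply Rmult_le_pos; lra). lra. }
  specialize (M z Hz). unfold v in M. rewrite ln_sqd in M by lra. lra.
Qed.

Lemma seg_derive (U : pset) v vx vy q p t : is_open U -> C1 U v vx vy -> U (seg q p t) ->
  is_derive (fun t => v (seg q p t)) t (along (fst p - fst q) (snd p - snd q) vx vy (seg q p t)).
Proof.
  intros HU H Ht. unfold seg, along.
  evar_last. apply (C1_comp U v vx vy (fun t => fst q + t * (fst p - fst q))
    (fun t => snd q + t * (snd p - snd q)) t (fst p - fst q) (snd p - snd q)); auto.
  auto_derive; auto; ring. auto_derive; auto; ring. simpl; ring.
Qed.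

Section Associated.

Variables (Om : pset) (u gx gy : pt -> R).
Hypothesis HO : is_open Om.
Hypothesis Hh : harm Om u gx gy.
Hypothesis cu : continuous_on (closure Om) u.
Hypothesis cx : continuous_on (closure Om) gx.
Hypothesis cy : continuous_on (closure Om) gy.
Hypothesis unit_bd : forall p, boundary Om p -> gx p ^ 2 + gy p ^ 2 = 1.
Hypothesis pos : forall p, Om p -> 0 < u p.
Hypothesis zero_bd : forall p, boundary Om p -> u p = 0.

Lemma closure_nonneg p : closure Om p -> 0 <= u p.
Proof.
  intros H. destruct (classic (Om p)) as [Hp|Hp].
  apply Rlt_le, pos, Hp. rewrite zero_bd. lra. apply closure_boundary; auto.
Qed.

Lemma along_cw e1 e2 p : closure Om p ->
  continuous_within (closure Om) (along e1 e2 gx gy) p.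
Proof. intros H. apply cw_lin; auto. Qed.

(** Suppose m = u(p) / e^2 > d. Harnack gives u >= m on the circle of radius d/2, and the barrier
    then gives u >= m t at [seg q p t]. But the slope of u along this segment tends to (p - q) .
    grad u(q) <= d as t tends to 0, which is too small. *)
Lemma hopf p q d : boundary Om q -> dist q p = d -> 0 < d ->
  (forall z, disc p d z -> Om z) -> u p <= exp 2 * d.
Proof.
  intros Hq Ed Hd Hin. apply Rnot_lt_le. intros Hlt.
  assert (ex2 := exp_pos 2).
  set (m := u p / exp 2).
  assert (Em : u p = exp 2 * m) by (unfold m; field; lra).
  assert (Hm : d < m) by nra.
  assert (Hin' : forall t, 0 < t <= 1 -> Om (seg q p t)).
  { intros t Ht. apply Hin. unfold disc. rewrite seg_dist_r by lra. rewrite Ed. nra. }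
  assert (clo : forall z, dist z p <= d -> closure Om z).
  { intros z Hz e He. destruct (Rle_lt_or_eq_dec _ _ (dist_pos z p)) as [Zp|Zp].
    - set (t := Rmin 1 (e / dist z p) / 2).
      assert (e1 : 0 < e / dist z p) by (apply Rdiv_lt_0_compat; lra).
      assert (t1 : 0 < t < 1 /\ t < e / dist z p).
      { unfold t. assert (0 < Rmin 1 (e / dist z p)) by (apply Rmin_pos; lra).
        assert (A1 := Rmin_l 1 (e / dist z p)). assert (A2 := Rmin_r 1 (e / dist z p)). lra. }
      exists (seg z p t). split.
      + apply Hin. unfold disc. rewrite seg_dist_r by lra. nra.
      + rewrite dist_sym, seg_dist_l by lra.
        apply Rmult_lt_reg_r with (/ dist z p). apply Rinv_0_lt_compat; auto.
        rewrite Rmult_assoc, Rinv_r by lra. unfold Rdiv in t1. lra.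
    - exists z. rewrite dist_refl. split; auto. apply Hin. unfold disc. lra. }
  assert (hd : harm (disc p d) u gx gy).
  { destruct Hh as [A [Px [Py [B C]]]]. split. eapply C1_sub; eauto.
    exists Px, Py. split; eapply C1_sub; eauto. }
  assert (low : forall t, 0 < t <= / 2 -> m * t <= u (seg q p t)).
  { intros t Ht.
    assert (B : m * (ln d - ln (dist (seg q p t) p)) <= ln 2 * u (seg q p t)).
    { apply (annulus_barrier u gx gy p d m (seg q p t)); auto. lra.
      - intros; apply closure_nonneg; auto.
      - intros w Hw. apply (cw_sub _ (closure Om)); auto.
      - intros w Hw.
        assert (Har : u p <= exp 2 * u w).
        { apply (harnack (disc p d) u gx gy p (d / 2) w); auto. apply disc_open. lra.
          intros y Hy. replace (2 * (d / 2)) with d in Hy by field. auto. lra. }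
        rewrite Em in Har. apply Rmult_le_reg_l in Har; auto.
      - rewrite seg_dist_r by lra. rewrite Ed. nra. }
    rewrite seg_dist_r, Ed, ln_mult in B by lra.
    assert (L1 := ln_lower t ltac:(lra)). assert (L2 := ln2_bounds).
    assert (up := pos _ (Hin' t ltac:(lra))).
    assert (m * t <= m * (- ln (1 - t))) by (apply Rmult_le_compat_l; lra).
    nra. }
  assert (cq : closure Om q) by apply Hq.
  assert (G : along (fst p - fst q) (snd p - snd q) gx gy q <= d).
  { apply along_le. lra. assert (X := dist_sq p q). rewrite dist_sym, Ed in X. lra.
    rewrite unit_bd; auto. lra. }
  (* Any slope strictly between d and m works: by continuity of the gradient at q, k bounds the
     slope on a short initial piece. *)
  set (k := (d + m) / 2).
  destruct (along_cw (fst p - fst q) (snd p - snd q) q cq (k - d)) as [r [Hr Hk]].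
  { unfold k; lra. }
  set (t0 := Rmin (/ 2) (r / d / 2)).
  assert (T0 : 0 < t0 <= / 2 /\ t0 * d < r).
  { assert (0 < r / d) by (apply Rdiv_lt_0_compat; lra).
    assert (A1 := Rmin_l (/ 2) (r / d / 2)). assert (A2 := Rmin_r (/ 2) (r / d / 2)).
    fold t0 in A1, A2.
    split. split. apply Rmin_pos; lra. exact A1.
    apply Rle_lt_trans with (r / d / 2 * d). apply Rmult_le_compat_r; lra.
    replace (r / d / 2 * d) with (r / 2) by (field; lra). lra. }
  assert (slope : forall t, 0 < t <= t0 ->
     along (fst p - fst q) (snd p - snd q) gx gy (seg q p t) <= k).
  { intros t Ht. assert (X := Hk (seg q p t)).
    assert (Y : dist (seg q p t) q < r). { rewrite seg_dist_l by lra. rewrite Ed. nra. }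
    specialize (X (subset_closure _ _ (Hin' t ltac:(lra))) Y).
    apply Rabs_def2 in X. lra. }
  (* The partial derivatives are only given inside Om, so the mean value theorem is applied on
     [s, t0] with s > 0. Requiring u < (m - k) t0 at s yields u < m t0 - k s at t0, against the
     lower bound m t0. *)
  assert (hm : 0 < (m - k) * t0) by (apply Rmult_lt_0_compat; unfold k; lra).
  destruct (cu q cq _ hm) as [r' [Hr' Hu']].
  set (s := Rmin (t0 / 2) (r' / d / 2)).
  assert (S0 : 0 < s < t0 /\ s * d < r').
  { assert (0 < r' / d) by (apply Rdiv_lt_0_compat; lra).
    assert (A1 := Rmin_l (t0 / 2) (r' / d / 2)). assert (A2 := Rmin_r (t0 / 2) (r' / d / 2)).
    fold s in A1, A2.
    split. split. apply Rmin_pos; lra. lra.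
    apply Rle_lt_trans with (r' / d / 2 * d). apply Rmult_le_compat_r; lra.
    replace (r' / d / 2 * d) with (r' / 2) by (field; lra). lra. }
  assert (us : u (seg q p s) < (m - k) * t0).
  { assert (Y : dist (seg q p s) q < r'). { rewrite seg_dist_l by lra. rewrite Ed. lra. }
    specialize (Hu' (seg q p s) (subset_closure _ _ (Hin' s ltac:(lra))) Y).
    rewrite (zero_bd q Hq) in Hu'. apply Rabs_def2 in Hu'. lra. }
  assert (MV : exists c, Rmin s t0 <= c <= Rmax s t0 /\ u (seg q p t0) - u (seg q p s) =
     along (fst p - fst q) (snd p - snd q) gx gy (seg q p c) * (t0 - s)).
  { assert (Dv : forall t, s <= t <= t0 -> is_derive (fun t => u (seg q p t)) t
       (along (fst p - fst q) (snd p - snd q) gx gy (seg q p t))).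
    { intros t Ht. apply (seg_derive Om); auto. apply Hh. apply Hin'. lra. }
    apply (MVT_gen (fun t => u (seg q p t)) s t0
      (fun t => along (fst p - fst q) (snd p - snd q) gx gy (seg q p t)));
      rewrite Rmin_left, Rmax_right by lra.
    - intros t Ht. apply Dv. lra.
    - intros t Ht. apply continuity_pt_filterlim.
      apply (ex_derive_continuous (V := R_NormedModule)). eexists. apply Dv, Ht. }
  rewrite Rmin_left, Rmax_right in MV by lra. destruct MV as [c [Hc E]].
  assert (Sc := slope c ltac:(lra)). assert (Lw := low t0 ltac:(lra)).
  assert (k0 : 0 < k) by (unfold k; lra).
  assert (0 <= k * s) by nra. nra.
Qed.

Hypothesis Hext : exists q, ~ Om q.

Lemma gradient_bounded p e1 e2 : Om p -> e1 ^ 2 + e2 ^ 2 <= 1 ->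
  along e1 e2 gx gy p <= 2 * exp 2.
Proof.
  intros Hp He.
  destruct (nearest_boundary_point Om p HO Hp Hext) as [q [Hq [_ [Hd Hin]]]].
  assert (H1 := hopf p q _ Hq eq_refl Hd Hin).
  assert (H2 := grad_bound Om u gx gy p (dist q p) HO Hh Hin e1 e2 Hd
    (fun z Hz => Rlt_le _ _ (pos z (Hin z Hz))) He).
  apply Rmult_le_reg_r with (dist q p). exact Hd. unfold along. lra.
Qed.

(* Phragmen-Lindelof: near infinity the bounded function is beaten by a small multiple of the logarithm. *)
Lemma gradient_le_1 c r p e1 e2 : 0 < r -> (forall z, closure Om z -> r <= dist z c) ->
  Om p -> e1 ^ 2 + e2 ^ 2 <= 1 -> along e1 e2 gx gy p <= 1.
Proof.
  intros Hr Hc Hp He.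
  set (C := 2 * exp 2).
  (* Measuring the logarithm from the excluded radius r makes log(|z - c| / r) nonnegative on the
     whole closure. *)
  set (Lp := ln (dist p c) - ln r).
  assert (rp : r <= dist p c) by (apply Hc, subset_closure, Hp).
  assert (L0 : 0 <= Lp) by (assert (X := ln_le r (dist p c) Hr rp); unfold Lp; lra).
  assert (key : forall ep, 0 < ep -> along e1 e2 gx gy p <= 1 + ep * Lp).
  { intros ep Hep.
    (* At radius r exp(C / ep) the term ep log(|z - c| / r) reaches the crude bound C; the maximum
       with |p - c| keeps p inside the truncated domain. *)
    set (B := Rmax (dist p c) (r * exp (C / ep))).
    assert (B1 : dist p c <= B) by apply Rmax_l.
    assert (B2 : r * exp (C / ep) <= B) by apply Rmax_r.
    assert (B3 : ln r + C / ep <= ln B).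
    { rewrite <- (ln_exp (C / ep)), <- ln_mult; auto using exp_pos.
      apply ln_le; auto. apply Rmult_lt_0_compat; auto using exp_pos. }
    assert (B4 : C <= ep * (ln B - ln r)).
    { apply Rle_trans with (ep * (C / ep)). right; field; lra. apply Rmult_le_compat_l; lra. }
    set (K := fun q => closure Om q /\ dist q c <= B).
    set (V := fun q => Om q /\ disc c B q).
    set (v := fun q => 1 * along e1 e2 gx gy q + - ep / 2 * ln (sqd c q)).
    assert (M : forall q, K q -> v q <= 1 - ep * ln r).
    { apply (max_principle K V v _ c B).
      - apply closed_inter_ball, closure_closed.
      - intros q [_ H]; exact H.
      - intros q [H1 H2]. unfold v. apply cw_lin.
        + apply (cw_sub _ (closure Om)). intros z [H _]; exact H. apply along_cw, H1.
        + apply cw_cont, (MVP_ln c), punct_dist. specialize (Hc q H1). lra.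
      - intros q [H1 H2]. destruct (HO q H1) as [d [Hd Hd']].
        destruct (disc_open c B q H2) as [d2 [Hd2 Hd2']].
        exists (Rmin d d2). split. apply Rmin_pos; auto. intros z Hz. split.
        apply Hd'. eapply Rlt_le_trans; [exact Hz|apply Rmin_l].
        apply Hd2'. eapply Rlt_le_trans; [exact Hz|apply Rmin_r].
      - intros q [H1 H2]. split. apply subset_closure, H1. apply Rlt_le, H2.
      - apply MVP_lin.
        + apply (MVP_sub Om). intros q [H _]; exact H. apply MVP_lin; apply (MVP_harm Om u gx gy HO Hh).
        + eapply MVP_sub; [|apply MVP_ln]. intros q [H1 H2]. apply punct_dist.
          specialize (Hc q (subset_closure _ _ H1)). lra.
      - intros q [H1 H2] Hn. unfold v. assert (rq := Hc q H1). rewrite ln_sqd by lra.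
        assert (lq := ln_le r (dist q c) Hr rq).
        destruct (classic (Om q)) as [Oq|Oq].
        + assert (E : dist q c = B).
          { apply Rle_antisym; auto. apply Rnot_lt_le. intros X. apply Hn. split; auto. }
          rewrite E. assert (G := gradient_bounded q e1 e2 Oq He). fold C in G. lra.
        + assert (G : along e1 e2 gx gy q <= 1).
          { apply along_le. lra. lra. rewrite unit_bd. lra. apply closure_boundary; auto. }
          assert (ep * ln r <= ep * ln (dist q c)) by (apply Rmult_le_compat_l; lra). lra. }
    assert (Kp : K p) by (split; auto; apply subset_closure, Hp).
    specialize (M p Kp). unfold v in M. rewrite ln_sqd in M by lra. unfold Lp. lra. }
  apply Rnot_lt_le. intros Hlt.
  set (x := along e1 e2 gx gy p - 1) in *.
  assert (X : 0 < x) by (unfold x; lra).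
  (* With this ep the error ep Lp is at most half of the supposed excess x; the added 1 covers Lp =
     0. *)
  assert (H := key (x / (2 * (Lp + 1))) ltac:(apply Rdiv_lt_0_compat; lra)).
  assert (x / (2 * (Lp + 1)) * Lp <= x / 2).
  { replace (x / 2) with (x / (2 * (Lp + 1)) * (Lp + 1)) by (field; lra).
    apply Rmult_le_compat_l; [|lra]. apply Rlt_le, Rdiv_lt_0_compat; lra. }
  unfold x in *. lra.
Qed.

End Associated.

(** * The equality case *)

Lemma connected_invariant (Om A : pset) p : is_open Om -> connected Om -> Om p -> A p ->
  (forall q, Om q -> A q -> exists e, 0 < e /\ forall z, dist z q < e -> A z) ->
  (forall q, Om q -> ~ A q -> exists e, 0 < e /\ forall z, dist z q < e -> ~ A z) ->
  forall q, Om q -> A q.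
Proof.
  intros HO HC Hp Ap H1 H2 q Hq. apply NNPP. intros Nq. apply HC.
  assert (G : forall X : pset, (forall q, Om q -> X q -> exists e, 0 < e /\ forall z, dist z q < e -> X z) ->
    is_open (fun z => Om z /\ X z)).
  { intros X HX z [Oz Xz]. destruct (HO z Oz) as [d [Hd Hd']], (HX z Oz Xz) as [e [He He']].
    exists (Rmin d e). split. apply Rmin_pos; auto. intros w Hw. split.
    apply Hd'. eapply Rlt_le_trans; [exact Hw|apply Rmin_l].
    apply He'. eapply Rlt_le_trans; [exact Hw|apply Rmin_r]. }
  exists (fun z => Om z /\ A z), (fun z => Om z /\ ~ A z).
  split; [apply G; exact H1|]. split; [apply G; exact H2|].
  split. { intros z Hz. destruct (classic (A z)); auto. }
  split. { exists p; auto. } split. { exists q; auto. }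
  tauto.
Qed.

Lemma polar_angle (a b : R) : a ^ 2 + b ^ 2 = 1 ->
  exists t, 0 <= t <= 2 * PI /\ cos t = a /\ sin t = b.
Proof.
  intros H. assert (B2 := pow2_ge_0 b). assert (A2 := pow2_ge_0 a).
  assert (Ha : -1 <= a <= 1) by (split; nra).
  assert (AB := acos_bound a). assert (C := cos_acos a Ha). assert (S := sin_acos a Ha).
  assert (E : 1 - Rsqr a = Rsqr b) by (unfold Rsqr; lra).
  rewrite E, sqrt_Rsqr_abs in S.
  destruct (Rle_dec 0 b) as [Hb|Hb].
  - exists (acos a). rewrite Rabs_pos_eq in S by auto. repeat split; auto; lra.
  - exists (2 * PI - acos a). rewrite Rabs_left in S by lra.
    rewrite cos_minus, sin_minus, cos_2PI, sin_2PI, C, S. repeat split; lra.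
Qed.

(** The primitive of g is monotone with equal values at a and b, hence constant, so its derivative g
    vanishes inside. Continuity reaches the endpoints. *)
Lemma RInt_nonneg_eq0 (g : R -> R) a b : a < b -> (forall t, continuous g t) ->
  (forall t, 0 <= g t) -> RInt g a b = 0 -> forall t, a <= t <= b -> g t = 0.
Proof.
  intros Hab Hc Hg H0 t Ht.
  assert (ex : forall x y, ex_RInt g x y).
  { intros. apply (ex_RInt_continuous (V := R_CompleteNormedModule)). auto. }
  set (F := fun x => RInt g a x).
  assert (mono : forall x y, x <= y -> F x <= F y).
  { intros x y Hxy. unfold F. rewrite <- (RInt_Chasles g a x y) by apply ex.
    assert (P : 0 <= RInt g x y) by (apply RInt_ge_0; auto).
    unfold plus; simpl. lra. }
  assert (Fa : F a = 0) by apply (RInt_point (V := R_CompleteNormedModule)).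
  assert (zero : forall x, a <= x <= b -> F x = 0).
  { intros x Hx. apply Rle_antisym. rewrite <- H0. apply mono; lra. rewrite <- Fa. apply mono; lra. }
  assert (inner : forall x, a < x < b -> g x = 0).
  { intros x Hx.
    assert (D : is_derive F x (g x)).
    { apply (is_derive_RInt g F a x); auto. apply filter_forall. intros y.
      apply (RInt_correct (V := R_CompleteNormedModule)), ex. }
    assert (D0 : is_derive F x 0).
    { apply (is_derive_ext_loc (fun _ => 0)); [|apply (is_derive_const (V := R_NormedModule))].
      assert (P : 0 < Rmin (x - a) (b - x)) by (apply Rmin_pos; lra).
      exists (mkposreal _ P).
      assert (Z : forall y : R, Rabs (y - x) < Rmin (x - a) (b - x) -> 0 = F y).
      { intros y Hy. symmetry. apply zero. apply Rabs_def2 in Hy.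
        assert (A1 := Rmin_l (x - a) (b - x)). assert (A2 := Rmin_r (x - a) (b - x)). lra. }
      intros y Hy. apply Z, Hy. }
    rewrite <- (is_derive_unique _ _ _ D). apply (is_derive_unique _ _ _ D0). }
  apply NNPP. intros N. assert (P : 0 < g t) by (specialize (Hg t); lra).
  destruct (Hc t (fun y => 0 < y)) as [d Hd].
  { exists (mkposreal _ P). 
    assert (Z : forall y : R, Rabs (y - g t) < g t -> 0 < y).
    { intros y Hy. apply Rabs_def2 in Hy. lra. }
    intros y Hy. apply Z, Hy. }
  assert (Z : forall y : R, Rabs (y - t) < d -> 0 < g y) by exact Hd.
  assert (d0 := cond_pos d).
  (* A step of length s towards the farther endpoint stays in the open interval, where g is 0, and
     also in the neighbourhood where g > 0. *)
  set (s := Rmin (d / 2) ((b - a) / 4)).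
  assert (s0 : 0 < s) by (apply Rmin_pos; lra).
  assert (A1 : s <= d / 2) by apply Rmin_l. assert (A2 : s <= (b - a) / 4) by apply Rmin_r.
  destruct (Rle_dec t ((a + b) / 2)) as [Hl|Hl].
  - assert (X := inner (t + s) ltac:(lra)). assert (Y := Z (t + s)).
    replace (t + s - t) with s in Y by ring. rewrite Rabs_pos_eq in Y by lra. specialize (Y ltac:(lra)). lra.
  - assert (X := inner (t - s) ltac:(lra)). assert (Y := Z (t - s)).
    replace (t - s - t) with (- s) in Y by ring. rewrite Rabs_Ropp, Rabs_pos_eq in Y by lra.
    specialize (Y ltac:(lra)). lra.
Qed.

(** Around a point where v = M, the nonnegative function M - v has zero mean on each small circle,
    so it vanishes there. These circles fill a disc, so the set where v = M is open; continuity
    makes its complement in Om open. *)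
Lemma strong_max_principle (Om : pset) v M p : is_open Om -> connected Om -> MVP Om v ->
  (forall q, Om q -> v q <= M) -> Om p -> v p = M -> forall q, Om q -> v q = M.
Proof.
  intros HO HC [cv Mv] HM Hp Ep.
  apply (connected_invariant Om (fun q => v q = M) p); auto.
  - intros q Hq Eq. destruct (HO q Hq) as [d [Hd Hin]]. exists d. split; auto.
    intros z Hz. destruct (Rle_lt_or_eq_dec _ _ (dist_pos z q)) as [Hs|Hs];
      [|symmetry in Hs; apply dist_eq0 in Hs; congruence].
    set (s := dist z q) in *.
    assert (Ez : s ^ 2 = (fst z - fst q) ^ 2 + (snd z - snd q) ^ 2) by apply dist_sq.
    destruct (polar_angle ((fst z - fst q) / s) ((snd z - snd q) / s)) as [t [Ht [Ct St]]].
    { replace (((fst z - fst q) / s) ^ 2 + ((snd z - snd q) / s) ^ 2) with (s ^ 2 / s ^ 2)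
        by (rewrite Ez at 1; field; lra). field; lra. }
    assert (Zc : circ q s t = z).
    { unfold circ. rewrite Ct, St. destruct z; simpl. f_equal; field; lra. }
    assert (As : Rabs s < d) by (apply Rabs_def1; lra).
    assert (On : forall a, Om (circ q s a)) by (intros; apply Hin; rewrite circ_dist; exact As).
    assert (cc : forall a, continuous (fun a => v (circ q s a)) a).
    { intros. apply cont_circ, cv, On. }
    assert (K0 := PI_RGT_0).
    assert (X : M - v (circ q s t) = 0).
    { apply (RInt_nonneg_eq0 (fun a => M - v (circ q s a)) 0 (2 * PI)); auto. lra.
      - intros a. apply (continuous_minus (V := R_NormedModule)). apply continuous_const. apply cc.
      - intros a. specialize (HM _ (On a)). lra.
      - apply is_RInt_unique. evar_last.
        apply (is_RInt_minus (V := R_NormedModule)). apply is_RInt_const.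
        apply (RInt_correct (V := R_CompleteNormedModule)).
        apply (ex_RInt_continuous (V := R_CompleteNormedModule)). intros; apply cc.
        assert (Y := Mv q d s Hin ltac:(lra)). unfold cint in Y. rewrite Y, Eq.
        unfold minus, plus, opp, scal; simpl. unfold mult; simpl. ring. }
    rewrite Zc in X. lra.
  - intros q Hq Nq. assert (E : 0 < M - v q) by (specialize (HM q Hq); lra).
    destruct (proj1 (cont_dist v q) (cv q Hq) _ E) as [d [Hd H]]. exists d. split; auto.
    intros z Hz Ez. specialize (H z Hz). apply Rabs_def2 in H. lra.
Qed.

Lemma constant_of_zero_gradient (Om : pset) w wx wy p : is_open Om -> connected Om ->
  C1 Om w wx wy -> (forall q, Om q -> wx q = 0 /\ wy q = 0) -> Om p ->
  forall q, Om q -> w q = w p.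
Proof.
  intros HO HC Hw H0 Hp.
  apply (connected_invariant Om (fun q => w q = w p) p); auto.
  - intros q Hq Eq. destruct (HO q Hq) as [d [Hd Hin]]. exists d. split; auto.
    intros z Hz. rewrite <- Eq.
    assert (On : forall t, 0 <= t <= 1 -> Om (seg q z t)).
    { intros t Ht. apply Hin. rewrite seg_dist_l by lra. rewrite (dist_sym q z).
      assert (Z := dist_pos z q). nra. }
    assert (D : forall t, 0 <= t <= 1 -> is_derive (fun t => w (seg q z t)) t 0).
    { intros t Ht. evar_last. apply (seg_derive Om w wx wy); auto.
      unfold along. destruct (H0 _ (On t Ht)) as [-> ->]. ring. }
    assert (E := eq_of_derive0 (fun t => w (seg q z t)) 1 ltac:(lra)
      (fun t Ht => ex_derive_continuous (V := R_NormedModule) _ _ (ex_intro _ _ (D t Ht)))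
      (fun t Ht => D t (conj (Rlt_le _ _ (proj1 Ht)) (Rlt_le _ _ (proj2 Ht))))).
    simpl in E. unfold seg in E. destruct q as [q1 q2], z as [z1 z2]. simpl in E.
    replace (q1 + 1 * (z1 - q1)) with z1 in E by ring.
    replace (q2 + 1 * (z2 - q2)) with z2 in E by ring.
    replace (q1 + 0 * (z1 - q1)) with q1 in E by ring.
    replace (q2 + 0 * (z2 - q2)) with q2 in E by ring. exact E.
  - intros q Hq Nq. assert (E : 0 < Rabs (w q - w p)) by (apply Rabs_pos_lt; lra).
    assert (c : cont w q) by (eapply C1_cont; eauto).
    destruct (proj1 (cont_dist w q) c _ E) as [d [Hd H]]. exists d. split; auto.
    intros z Hz Ez. specialize (H z Hz). rewrite Ez, Rabs_minus_sym in H. lra.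
Qed.

(** The supremum of the parameters with [seg p z t] in Om works: openness keeps that point out of
    Om, and the supremum property puts it in the closure. *)
Lemma segment_meets_boundary (Om : pset) p z : is_open Om -> Om p -> ~ Om z ->
  exists t, 0 <= t <= 1 /\ boundary Om (seg p z t) /\ ~ Om (seg p z t).
Proof.
  intros HO Hp Hz.
  assert (s0 : seg p z 0 = p) by (destruct p; unfold seg; simpl; f_equal; ring).
  assert (s1 : seg p z 1 = z) by (destruct z; unfold seg; simpl; f_equal; ring).
  assert (near : forall t t', dist (seg p z t) (seg p z t') = Rabs (t - t') * dist p z).
  { intros t t'. assert (X := dist_sq (seg p z t) (seg p z t')). assert (Y := dist_sq p z).
    assert (Z := dist_pos (seg p z t) (seg p z t')). assert (Z' := dist_pos p z).
    assert (A := Rabs_pos (t - t')).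
    unfold seg in X at 3 4 5 6; simpl fst in X; simpl snd in X.
    assert (W : dist (seg p z t) (seg p z t') ^ 2 = (Rabs (t - t') * dist p z) ^ 2).
    { rewrite X, Rpow_mult_distr, Y, pow2_abs. ring. }
    apply Rle_antisym; apply le_of_sq_le; nra. }
  assert (dp := dist_pos p z).
  destruct (completeness (fun t => 0 <= t <= 1 /\ Om (seg p z t))) as [s [ub lub]].
  { exists 1. intros t [Ht _]. lra. }
  { exists 0. rewrite s0. split; auto. lra. }
  assert (S0 : 0 <= s) by (apply ub; rewrite s0; split; auto; lra).
  assert (S1 : s <= 1) by (apply lub; intros t [Ht _]; lra).
  assert (Ns : ~ Om (seg p z s)).
  { intros Os. assert (s < 1).
    { destruct (Rle_lt_or_eq_dec _ _ S1) as [|E]; auto. rewrite E, s1 in Os. contradiction. }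
    destruct (HO _ Os) as [d [Hd Hin]].
    set (h := Rmin (1 - s) (d / (2 * (dist p z + 1)))).
    assert (q0 : 0 < d / (2 * (dist p z + 1))) by (apply Rdiv_lt_0_compat; lra).
    assert (h0 : 0 < h) by (apply Rmin_pos; lra).
    assert (A1 : h <= 1 - s) by apply Rmin_l.
    assert (A2 : h <= d / (2 * (dist p z + 1))) by apply Rmin_r.
    assert (X : s + h <= s); [|lra]. apply ub. split. lra. apply Hin. rewrite near.
    replace (s + h - s) with h by ring. rewrite Rabs_pos_eq by lra.
    apply Rle_lt_trans with (d / (2 * (dist p z + 1)) * (dist p z + 1)).
    apply Rmult_le_compat; lra. replace (d / (2 * (dist p z + 1)) * (dist p z + 1)) with (d / 2)
      by (field; lra). lra. }
  exists s. split; [lra|]. split; auto. apply closure_boundary; auto.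
  intros e He.
  assert (q0 : 0 < e / (dist p z + 1)) by (apply Rdiv_lt_0_compat; lra).
  assert (X : exists t, (0 <= t <= 1 /\ Om (seg p z t)) /\ s - e / (dist p z + 1) < t).
  { apply NNPP. intros N. assert (s <= s - e / (dist p z + 1)); [|lra].
    apply lub. intros t Ht. apply Rnot_lt_le. intros L. apply N. exists t. auto. }
  destruct X as [t [[Ht Ot] Lt]]. exists (seg p z t). split; auto. rewrite near.
  assert (t <= s) by (apply ub; auto). rewrite Rabs_pos_eq by lra.
  apply Rle_lt_trans with ((s - t) * (dist p z + 1)). apply Rmult_le_compat_l; lra.
  replace e with (e / (dist p z + 1) * (dist p z + 1)) by (field; lra).
  apply Rmult_lt_compat_r; lra.
Qed.

(** A smooth boundary has Om on one side only: a chart carries a point just below the axis to a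
    point outside both Om and its boundary, hence outside the closed set [closure Om]. *)
Lemma exterior_disc (Om : pset) : smooth_domain Om ->
  exists c r, 0 < r /\ (forall z, closure Om z -> r <= dist z c) /\ ~ Om c.
Proof.
  intros [HO [[z0 Hz0] Hch]].
  destruct (Hch z0 Hz0) as [eps [psi [phi [D [He [HD [H1 [H2 [_ [_ [H3 H4]]]]]]]]]]].
  assert (B0 : D (psi z0) /\ snd (psi z0) = 0).
  { apply H4. exists z0. repeat split; auto. unfold disc. rewrite dist_refl. exact He. apply Hz0. apply Hz0. }
  destruct B0 as [D0 S0]. destruct (HD _ D0) as [d [Hd HDd]].
  set (w := (fst (psi z0), - d / 2) : pt).
  assert (Dw : D w).
  { apply HDd. eapply Rle_lt_trans. apply dist_le_abs. unfold w; simpl. rewrite S0.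
    replace (fst (psi z0) - fst (psi z0)) with 0 by ring.
    replace (- d / 2 - 0) with (- (d / 2)) by field.
    rewrite Rabs_R0, Rabs_Ropp, Rabs_pos_eq by lra. lra. }
  destruct (H2 w Dw) as [Pd Pw].
  assert (N1 : ~ Om (phi w)).
  { intros O. assert (X : D w /\ snd w > 0) by (apply H3; exists (phi w); auto).
    destruct X as [_ X]. simpl in X. lra. }
  assert (N2 : ~ boundary Om (phi w)).
  { intros O. assert (X : D w /\ snd w = 0) by (apply H4; exists (phi w); auto).
    destruct X as [_ X]. simpl in X. lra. }
  assert (N3 : ~ closure Om (phi w)) by (intros X; apply N2, closure_boundary; auto).
  destruct (closure_closed Om _ N3) as [r [Hr Hin]].
  exists (phi w), r. split; auto. split; auto. intros z Hz. apply Rnot_lt_le. intros X.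
  apply (Hin z X Hz).
Qed.

Theorem mainTheorem3 (Om : pset) (u : pt -> R) :
  exceptional_domain Om ->
  finitely_many_components (boundary Om) ->
  ~ is_half_plane Om ->
  is_associated_function Om u ->
  forall p, Om p ->
    forall ux uy, partial_x u p ux -> partial_y u p uy ->
      sqrt (ux ^ 2 + uy ^ 2) < 1.
Proof.
  intros [Hsm [HC _]] _ Hhp [Hharm [[gx [gy [Hg [cu [cx [cy Hbd]]]]]] [Hpos Hz]]]
    p Hp ux uy Hux Huy.
  assert (HO : is_open Om) by apply Hsm.
  assert (sub : forall f, continuous_on (closure Om) f -> continuous_on Om f).
  { intros f Hf q Hq. apply (cw_sub _ (closure Om)). apply subset_closure.
    apply Hf, subset_closure, Hq. }
  assert (Hh : harm Om u gx gy).
  { apply harm_of_harmonic_on; auto. intros q Hq. split; eapply cont_of_on; eauto. }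
  assert (unit_bd : forall q, boundary Om q -> gx q ^ 2 + gy q ^ 2 = 1).
  { intros q Hq. assert (A1 := pow2_ge_0 (gx q)). assert (A2 := pow2_ge_0 (gy q)).
    rewrite <- (pow2_sqrt (gx q ^ 2 + gy q ^ 2)) by lra. rewrite Hbd by auto. ring. }
  destruct (exterior_disc Om Hsm) as [c [r [Hr [Hext Nc]]]].
  rewrite (partial_x_unique _ _ _ _ Hux (proj1 (Hg p Hp))).
  rewrite (partial_y_unique _ _ _ _ Huy (proj2 (Hg p Hp))).
  set (n := sqrt (gx p ^ 2 + gy p ^ 2)).
  assert (A1 := pow2_ge_0 (gx p)). assert (A2 := pow2_ge_0 (gy p)).
  assert (n2 : n ^ 2 = gx p ^ 2 + gy p ^ 2) by (apply pow2_sqrt; lra).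
  apply Rnot_le_lt. intros Hn. apply Hhp.
  (* In the direction of grad u(p) the derivative at p is n >= 1, while no directional derivative
     exceeds 1; so it attains its maximum 1 at p. *)
  set (e1 := gx p / n). set (e2 := gy p / n).
  assert (He : e1 ^ 2 + e2 ^ 2 = 1).
  { unfold e1, e2. replace ((gx p / n) ^ 2 + (gy p / n) ^ 2) with ((gx p ^ 2 + gy p ^ 2) / n ^ 2)
      by (field; lra). rewrite <- n2. field. lra. }
  assert (bound : forall a b q, Om q -> a ^ 2 + b ^ 2 <= 1 -> along a b gx gy q <= 1).
  { intros a b q Hq Hab. apply (gradient_le_1 Om u gx gy HO Hh cu cx cy unit_bd Hpos Hz
      (ex_intro _ c Nc) c r); auto. }
  assert (Ep : along e1 e2 gx gy p = 1).
  { apply Rle_antisym. apply bound; auto; lra.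
    assert (E : along e1 e2 gx gy p = n).
    { unfold along, e1, e2. replace (gx p / n * gx p + gy p / n * gy p) with
        ((gx p ^ 2 + gy p ^ 2) / n) by (field; lra). rewrite <- n2. field. lra. }
    rewrite E. exact Hn. }
  assert (Eall : forall q, Om q -> along e1 e2 gx gy q = 1).
  { apply (strong_max_principle Om (along e1 e2 gx gy) 1 p); auto.
    - apply MVP_lin; apply (MVP_harm Om u gx gy HO Hh).
    - intros q Hq. apply bound; auto; lra. }
  assert (grad : forall q, Om q -> gx q = e1 /\ gy q = e2).
  { intros q Hq. specialize (Eall q Hq). unfold along in Eall.
    assert (N : gx q ^ 2 + gy q ^ 2 <= 1).
    { assert (B1 := pow2_ge_0 (gx q)). assert (B2 := pow2_ge_0 (gy q)).
      set (k := sqrt (gx q ^ 2 + gy q ^ 2)).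
      assert (k2 : k ^ 2 = gx q ^ 2 + gy q ^ 2) by (apply pow2_sqrt; lra).
      assert (k0 : 0 <= k) by apply sqrt_pos.
      apply Rnot_lt_le. intros K1. assert (K2 : 1 < k) by (apply Rnot_le_lt; intros X; nra).
      assert (K3 : along (gx q / k) (gy q / k) gx gy q <= 1).
      { apply bound; auto. right.
        replace ((gx q / k) ^ 2 + (gy q / k) ^ 2) with ((gx q ^ 2 + gy q ^ 2) / k ^ 2)
          by (field; lra). rewrite <- k2. field. lra. }
      assert (E : along (gx q / k) (gy q / k) gx gy q = k).
      { unfold along. replace (gx q / k * gx q + gy q / k * gy q) with
          ((gx q ^ 2 + gy q ^ 2) / k) by (field; lra). rewrite <- k2. field. lra. }
      lra. }
    (* Equality in Cauchy-Schwarz: |grad u - e|^2 = |grad u|^2 - 2 + 1 <= 0. *)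
    assert (Z : Rsqr (gx q - e1) + Rsqr (gy q - e2) = 0).
    { apply Rle_antisym. unfold Rsqr. lra.
      apply Rplus_le_le_0_compat; apply Rle_0_sqr. }
    destruct (Rplus_sqr_eq_0 _ _ Z). lra. }
  set (l := fun q : pt => e1 * (fst q - fst p) + e2 * (snd q - snd p)).
  assert (lin : forall q, Om q -> u q - l q = u p).
  { intros q Hq.
    assert (Hw := C1_plus Om _ _ _ _ _ _ (proj1 Hh) (C1_lin Om (- e1) (- e2) p)).
    assert (E := constant_of_zero_gradient Om _ _ _ p HO HC Hw).
    cbv beta in E. unfold l. rewrite <- (Rplus_0_r (u p)).
    assert (E' : forall z, Om z -> gx z + - e1 = 0 /\ gy z + - e2 = 0).
    { intros z Oz. destruct (grad z Oz). lra. }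
    specialize (E E' Hp q Hq). lra. }
  (* This is the half-plane on which the affine function l + u(p), equal to u on Om, is positive. *)
  exists e1, e2, (e1 * fst p + e2 * snd p - u p). split.
  { destruct (Req_dec e1 0) as [Z|]; auto. right. intros Z'. rewrite Z, Z' in He. lra. }
  intros q. split.
  - intros Hq. specialize (lin q Hq). specialize (Hpos q Hq). unfold l in lin. lra.
  (* The affine function is positive at p and at q, hence on the segment between them. If q were
     outside Om, the segment would meet the boundary, where the affine function agrees with u by
     continuity and so vanishes. *)
  - intros Hq. apply NNPP. intros Nq.
    destruct (segment_meets_boundary Om p q HO Hp Nq) as [t [Ht [Bt _]]].
    set (z := seg p q t) in *.
    assert (uz : u z - l z = u p).
    { assert (ct : continuous_within (closure Om) (fun q => 1 * u q + -1 * l q) z).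
      { apply cw_lin. apply cu, Bt. apply cw_cont.
        eapply (C1_cont (fun _ => True)); [|apply C1_lin|]; auto.
        intros w _. exists 1. split; auto. lra. }
      apply NNPP. intros N. assert (X : 0 < Rabs (u z - l z - u p)) by (apply Rabs_pos_lt; lra).
      destruct (ct _ X) as [d [Hd Hin]]. destruct (proj1 Bt d Hd) as [w [Ow Dw]].
      rewrite dist_sym in Dw. specialize (Hin w (subset_closure _ _ Ow) Dw).
      assert (lw := lin w Ow).
      replace (1 * u w + -1 * l w - (1 * u z + -1 * l z)) with (- (u z - l z - u p)) in Hin by lra.
      rewrite Rabs_Ropp in Hin. lra. }
    rewrite (Hz z Bt) in uz. unfold l, z, seg in uz; simpl in uz.
    specialize (Hpos p Hp).
    assert (0 <= t * (e1 * (fst q - fst p) + e2 * (snd q - snd p) + u p)) by (apply Rmult_le_pos; lra).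
    assert (0 <= (1 - t) * u p) by (apply Rmult_le_pos; lra).
    destruct (Req_dec t 0) as [E|E].
    + rewrite E in uz. lra.
    + assert (0 < t * (e1 * (fst q - fst p) + e2 * (snd q - snd p) + u p)) by (apply Rmult_lt_0_compat; lra).
      lra.
Qed.
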